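(* Let $f_1,\dots,f_k \in \mathbb{C}[t_1^{\pm1},\dots,t_d^{\pm1}]$ be Laurent polynomials with real nonnegative coefficients, with Newton polytopes $P_i = \mathrm{Newt}(f_i)$, such that $P = P_1+\cdots+P_k$ is $d$-dimensional and has exactly $n=d+k$ facets, and such that the associated matrix $M\in\mathbb{Z}^{n\times n}$ (defined in the context) satisfies $\det M=\pm1$. Let $U\subset\mathbb{C}^n$ be the corresponding positive chart of $X_{\Sigma_P}$, and $U_{\geq0} = U\cap\mathbb{R}^n_{\geq0}$. For any $s=(s_1,\dots,s_k)\in\mathbb{R}^k_{>0}$, the restriction to $U_{\geq0}$ of the map $$\mu_{U,s}:U\to\mathbb{C}^n,\qquad u\mapsto\sum_{i=1}^k s_i\sum_{m\in P_i\cap\mathbb{Z}^d}c_{i,m}\,u^{\eta_i(m)}\,\eta_i(m)$$ is a homeomorphism onto its image, which is the $d$-dimensional polytope $$\mu_{U,s}(U_{\geq0}) = \{x\in\mathbb{R}^n : K^t x = s \text{ and } x\geq0\}.$$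
   Context: Write $f_i=\sum_{m\in P_i\cap\mathbb{Z}^d}c_{i,m}t^m$. $\mathrm{Newt}(f)$ is the convex hull of the exponents of the monomials of $f$. $\Sigma=\Sigma_P$ is the inner normal fan of $P$ (cones: for each face $Q$, the $w\in\mathbb{R}^d$ such that $\langle w,\cdot\rangle$ is minimized over $P$ at every point of $Q$), with primitive ray generators $\rho_1,\dots,\rho_n\in\mathbb{Z}^d$. Let $F=(\rho_1\ \cdots\ \rho_n)\in\mathbb{Z}^{d\times n}$ and $a_i=(a_{i,1},\dots,a_{i,n})^t$ with $a_{i,j}=-\min_{m\in P_i}\langle\rho_j,m\rangle$. $M$ is the $n\times n$ integer matrix whose first $d$ rows are those of $F$ and whose last $k$ rows are $a_1^t,\dots,a_k^t$. $K\in\mathbb{Z}^{n\times k}$ denotes the matrix formed by the last $k$ columns of $M^{-1}$. The exponent vectors are $\eta_i(m)=F^tm+a_i\in\mathbb{Z}^n_{\geq0}$ for $m\in P_i\cap\mathbb{Z}^d$. The inequality $x\ge 0$ is entrywise. Construction of $U$: for $B\in\mathbb{Z}^{p\times q}$ with columns $b_1,\dots,b_q$, $\phi_B:(\mathbb{C}^* )^p\to(\mathbb{C}^* )^q$ is the monomial map $t\mapsto(t^{b_1},\dots,t^{b_q})$. Let $\Gamma_{f^{-1}}:(\mathbb{C}^* )^d\setminus V(f_1\cdots f_k)\to(\mathbb{C}^* )^n$, $t\mapsto(t_1,\dots,t_d,f_1(t)^{-1},\dots,f_k(t)^{-1})$, and $\varphi=\phi_{M^{-t}}\circ\Gamma_{f^{-1}}$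 with $M^{-t}=(M^{-1})^t$. Then $U$ is the closure in $\mathbb{C}^n$ of $U^\circ=\mathrm{im}\,\varphi\subset(\mathbb{C}^* )^n$. The set $U_{\geq0}$ carries the Euclidean topology. *)

(* Defs.v *)
From HB Require Import structures.
From mathcomp Require Import all_boot all_order all_algebra finmap.
From mathcomp Require Import all_classical all_reals all_analysis.
From mathcomp Require Import complex.
(* Not imported: the notations of mpoly clash with those of analysis. *)
From mathcomp Require mpoly.
Set Implicit Arguments.
Unset Strict Implicit.
Unset Printing Implicit Defensive.
Import Order.TTheory GRing.Theory Num.Theory.
Import numFieldNormedType.Exports.
Local Open Scope classical_set_scope.
Local Open Scope ring_scope.
Local Open Scope complex_scope.

(* The library gives every numClosedFieldType its norm topology; the concrete
   type [R[i]] has to be told. *)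
#[non_forgetful_inheritance]
HB.instance Definition _ (R : realType) := PseudoPointedMetric.copy R[i] R[i]^o.

Definition intmx (C : nzRingType) m n (A : 'M[int]_(m, n)) : 'M[C]_(m, n) :=
  map_mx intr A.

Definition complexmx (R : realType) m n (A : 'M[R]_(m, n)) : 'M[R[i]]_(m, n) :=
  map_mx (real_complex R) A.

Definition dotv (R : realType) n (w x : 'cV[R]_n) : R := \sum_i w i 0 * x i 0.

Definition conv_hull (R : realType) n (A : set 'cV[R]_n) : set 'cV[R]_n :=
  smallest (@convex_set R 'cV[R]_n) A.

Definition is_polytope (R : realType) n (A : set 'cV[R]_n) :=
  exists2 B : set 'cV[R]_n, finite_set B & A = conv_hull B.

(* [V] is the direction space of the affine hull of [A]. *)
Definition has_dim (R : realType) n (A : set 'cV[R]_n) (r : nat) :=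
  A !=set0 /\ exists V : {vspace 'cV[R]_n},
    [/\ \dim V = r,
        forall x y, A x -> A y -> x - y \in V
      & forall W : {vspace 'cV[R]_n},
          (forall x y, A x -> A y -> x - y \in W) -> (V <= W)%VS].

Definition minkowski_sum (R : realType) n k (Q : 'I_k -> set 'cV[R]_n) :
    set 'cV[R]_n :=
  [set x | exists2 q : 'I_k -> 'cV[R]_n,
             (forall i, Q i (q i)) & x = \sum_i q i].

Definition is_minimum (R : realType) (A : set R) (v : R) := A v /\ lbound A v.

Definition is_face (R : realType) n (P Q : set 'cV[R]_n) :=
  Q !=set0 /\
  exists w, Q = [set x | P x /\ forall y, P y -> dotv w x <= dotv w y].

Definition is_facet (R : realType) n (P Q : set 'cV[R]_n) :=
  is_face P Q /\ exists2 r, has_dim P r.+1 & has_dim Q r.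

Definition normal_cone (R : realType) n (P Q : set 'cV[R]_n) : set 'cV[R]_n :=
  [set w | forall x y, Q x -> P y -> dotv w x <= dotv w y].

Definition normal_fan (R : realType) n (P : set 'cV[R]_n) :
    set (set 'cV[R]_n) :=
  [set normal_cone P Q | Q in is_face P].

Definition primitive n (m : 'cV[int]_n) :=
  \big[gcdn/0%N]_i absz (m i 0) = 1%N.

Definition is_ray_generator (R : realType) n (P : set 'cV[R]_n)
    (rho : 'cV[int]_n) :=
  primitive rho /\
  normal_fan P [set l *: intmx R rho | l in [set l : R | 0 <= l]].

(* The columns of [F] list the primitive ray generators, without repetition. *)
Definition is_ray_matrix (R : realType) d n (P : set 'cV[R]_d)
    (F : 'M[int]_(d, n)) :=
  injective (fun j => col j F) /\
  forall rho, is_ray_generator P rho <-> exists j, rho = col j F.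

(* A Laurent polynomial in [d] variables is its finitely supported family of
   coefficients, indexed by exponent vectors. *)
Notation laurent R d := {fsfun 'cV[int]_d -> R[i] with 0}.

(* With a nonnegative exponent this also makes sense at [u j 0 = 0], with
   [0 ^ 0 = 1]. *)
Definition monomial (C : fieldType) n (u : 'cV[C]_n) (e : 'cV[int]_n) : C :=
  \prod_j u j 0 ^ e j 0.

Definition laurent_eval (R : realType) d (f : laurent R d) (t : 'cV[R[i]]_d) :
    R[i] :=
  \sum_(m <- finsupp f) f m * monomial t m.

Definition newton (R : realType) d (f : laurent R d) : set 'cV[R]_d :=
  conv_hull [set intmx R m | m in [set` finsupp f]].

Definition support_matrix (R : realType) d k n (f : 'I_k -> laurent R d)
    (F : 'M[int]_(d, n)) (a : 'M[int]_(k, n)) :=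
  forall i j,
    is_minimum [set dotv (intmx R (col j F)) m | m in newton (f i)]
               (- (a i j)%:~R).

Definition torus (C : fieldType) n : set 'cV[C]_n :=
  [set t | forall j, t j 0 != 0].

Definition monomial_map (C : fieldType) p q (B : 'M[int]_(p, q))
    (t : 'cV[C]_p) : 'cV[C]_q :=
  \col_j monomial t (col j B).

Definition graph_inv (R : realType) d k (f : 'I_k -> laurent R d)
    (t : 'cV[R[i]]_d) : 'cV[R[i]]_(d + k) :=
  col_mx t (\col_i (laurent_eval (f i) t)^-1).

Definition graph_dom (R : realType) d k (f : 'I_k -> laurent R d) :
    set 'cV[R[i]]_d :=
  [set t | torus t /\ forall i, laurent_eval (f i) t != 0].

Definition zariski_closure (C : fieldType) n (A : set 'cV[C]_n) :
    set 'cV[C]_n :=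
  [set u | forall p : mpoly.mpoly n C,
     (forall v, A v -> mpoly.meval (fun j => v j 0) p = 0) ->
     mpoly.meval (fun j => u j 0) p = 0].

Definition chart_torus (R : realType) d k (f : 'I_k -> laurent R d)
    (M : 'M[int]_(d + k)) : set 'cV[R[i]]_(d + k) :=
  [set monomial_map (invmx M)^T (graph_inv f t) | t in graph_dom f].

Definition chart (R : realType) d k (f : 'I_k -> laurent R d)
    (M : 'M[int]_(d + k)) : set 'cV[R[i]]_(d + k) :=
  zariski_closure (chart_torus f M).

(* In [R[i]], [0 <= z] means that [z] is real and nonnegative. *)
Definition chart_ge0 (R : realType) d k (f : 'I_k -> laurent R d)
    (M : 'M[int]_(d + k)) : set 'cV[R[i]]_(d + k) :=
  [set u | chart f M u /\ forall j, 0 <= u j 0].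

Definition eta d n (F : 'M[int]_(d, n)) (ai : 'cV[int]_n) (m : 'cV[int]_d) :
    'cV[int]_n :=
  F^T *m m + ai.

Definition moment_map (R : realType) d k n (f : 'I_k -> laurent R d)
    (F : 'M[int]_(d, n)) (a : 'M[int]_(k, n)) (s : 'cV[R]_k)
    (u : 'cV[R[i]]_n) : 'cV[R[i]]_n :=
  \sum_i (s i 0)%:C *:
    \sum_(m \in [set m | newton (f i) (intmx R m)])
      (f i m * monomial u (eta F (row i a)^T m)) *:
        intmx R[i] (eta F (row i a)^T m).

Definition homeomorphic_onto_image (X Y : topologicalType) (A : set X)
    (h : X -> Y) :=
  {within A, continuous h} /\
  exists2 g : Y -> X, {in A, cancel h g} & {within h @` A, continuous g}.

(* Main.v *)
Require Import Defs.
From HB Require Import structures.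
From mathcomp Require Import all_boot all_order all_algebra finmap.
From mathcomp Require Import all_classical all_reals all_analysis.
From mathcomp Require Import complex ring lra.
From mathcomp Require mpoly.
Set Implicit Arguments.
Unset Strict Implicit.
Unset Printing Implicit Defensive.
Import Order.TTheory GRing.Theory Num.Theory.
Import numFieldNormedType.Exports.
Local Open Scope classical_set_scope.
Local Open Scope ring_scope.
Local Open Scope complex_scope.

(** With [M^-1 = (G | K)], the coordinates of [U] satisfy [u^eta_i(m) =
    t^m / f_i(t)], so on [U] the polynomials [h_i(u) = sum_m c_{i,m} u^eta_i(m)]
    are equal to 1. The torus [(R_{>0})^k] acts on [R^n] through the rows of [K],
    and [h_i] is homogeneous of degree [e_i]; moving a point [u + t(1,...,1)],
    [t > 0], to [h = 1] by this action and letting [t] tend to 0 shows that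
    [U_{>=0}] is the set [Y] of all [u >= 0] with [h_i(u) = 1].

    The geometric input is the completeness of the fan: every [w] is a nonnegative
    combination of rays on whose cone the support functions of the [P_i] are linear.
    As [M] is invertible, the coefficients of the combination are explicit, and the
    statement becomes [K h <= z] for all [z], where [h_i = min_m <eta_i(m), z>].
    With [z = - ln u] it bounds [Y], which is therefore compact; with [z] a small
    perturbation of the indicator function of [{j | u_j = 0}] it shows that
    no direction supported on [{j | u_j <> 0}] is orthogonal to all [eta_i(m)] with
    [u^eta_i(m) <> 0].

    The moment map is the gradient of the convex function [sum_i s_i h_i] in the
    coordinates [ln u]; the latter fact makes it injective on [Y], faces included.
    A point [x] of the polytope is the image of any maximizer of [u^x] on [Y]. A
    continuous injection of a compact space in a Hausdorff space is a
    homeomorphism onto its image. *)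

(** * Linear algebra *)

Section Dotv.
Variables (R : realType) (n : nat).
Implicit Types (u v w x : 'cV[R]_n) (l : R).

Lemma dotvE u v : dotv u v = (u^T *m v) 0 0.
Proof. by rewrite !mxE; apply: eq_bigr => i _; rewrite !mxE. Qed.

Lemma dotvC u v : dotv u v = dotv v u.
Proof. by apply: eq_bigr => i _; rewrite mulrC. Qed.

Lemma dotvDl u v w : dotv (u + v) w = dotv u w + dotv v w.
Proof. by rewrite -big_split; apply: eq_bigr => i _; rewrite mxE mulrDl. Qed.

Lemma dotvZl l u v : dotv (l *: u) v = l * dotv u v.
Proof. by rewrite mulr_sumr; apply: eq_bigr => i _; rewrite mxE mulrA. Qed.

Lemma dotvNl u v : dotv (- u) v = - dotv u v.
Proof. by rewrite -scaleN1r dotvZl mulN1r. Qed.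

Lemma dotvBl u v w : dotv (u - v) w = dotv u w - dotv v w.
Proof. by rewrite dotvDl dotvNl. Qed.

Lemma dotv0l v : dotv 0 v = 0.
Proof. by rewrite -(scale0r v) dotvZl mul0r. Qed.

Lemma dotvDr u v w : dotv u (v + w) = dotv u v + dotv u w.
Proof. by rewrite dotvC dotvDl !(dotvC u). Qed.

Lemma dotvZr l u v : dotv u (l *: v) = l * dotv u v.
Proof. by rewrite dotvC dotvZl dotvC. Qed.

Lemma dotvNr u v : dotv u (- v) = - dotv u v.
Proof. by rewrite dotvC dotvNl dotvC. Qed.

Lemma dotvBr u v w : dotv u (v - w) = dotv u v - dotv u w.
Proof. by rewrite dotvDr dotvNr. Qed.

Lemma dotv_sumr u I (r : seq I) (P : pred I) (g : I -> 'cV[R]_n) :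
  dotv u (\sum_(i <- r | P i) g i) = \sum_(i <- r | P i) dotv u (g i).
Proof.
apply: (big_morph (dotv u)); first exact: dotvDr.
by rewrite dotvC dotv0l.
Qed.

Lemma dotv_delta u j : dotv u (delta_mx j 0) = u j 0.
Proof.
rewrite /dotv (bigD1 j)//= mxE !eqxx mulr1 big1 ?addr0// => l lj.
by rewrite mxE (negPf lj) mulr0.
Qed.

Lemma dotvv_eq0 u : dotv u u = 0 -> u = 0.
Proof.
move=> /eqP; rewrite psumr_eq0 => [/allP u0|i _]; last by rewrite -expr2 sqr_ge0.
apply/colP => i; rewrite mxE; apply/eqP.
by have := u0 i (mem_index_enum _); rewrite mulf_eq0 orbb.
Qed.

End Dotv.

Section Intmx.
Variable C : nzRingType.

Lemma intmxD m n (A B : 'M[int]_(m, n)) :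
  intmx C (A + B) = intmx C A + intmx C B.
Proof. exact: map_mxD. Qed.

Lemma intmxB m n (A B : 'M[int]_(m, n)) :
  intmx C (A - B) = intmx C A - intmx C B.
Proof. exact: map_mxB. Qed.

Lemma intmxM m n p (A : 'M[int]_(m, n)) (B : 'M[int]_(n, p)) :
  intmx C (A *m B) = intmx C A *m intmx C B.
Proof. exact: map_mxM. Qed.

Lemma intmx_tr m n (A : 'M[int]_(m, n)) : intmx C A^T = (intmx C A)^T.
Proof. by rewrite /intmx map_trmx. Qed.

Lemma intmx_delta m n (i : 'I_m) (j : 'I_n) :
  intmx C (delta_mx i j) = delta_mx i j.
Proof. by apply/matrixP => l l'; rewrite !mxE; case: (_ && _). Qed.

Lemma intmx_col_mx m1 m2 n (A : 'M[int]_(m1, n)) (B : 'M[int]_(m2, n)) :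
  intmx C (col_mx A B) = col_mx (intmx C A) (intmx C B).
Proof. exact: map_col_mx. Qed.

Lemma intmx1 n : intmx C (1%:M : 'M[int]_n) = 1%:M.
Proof. exact: map_scalar_mx. Qed.

End Intmx.

Lemma dotv_col_mx (R : realType) p q (u u' : 'cV[R]_p) (v v' : 'cV[R]_q) :
  dotv (col_mx u v) (col_mx u' v') = dotv u u' + dotv v v'.
Proof.
rewrite /dotv big_split_ord /=; congr (_ + _); apply: eq_bigr => j _.
  by rewrite !col_mxEu.
by rewrite !col_mxEd.
Qed.

Lemma seq_min (T : eqType) (R : realDomainType) (g : T -> R) (s : seq T) :
  s != [::] -> exists2 x, x \in s & forall y, y \in s -> g x <= g y.
Proof.
elim: s => // a s IHs _; have [->|/IHs[x xs xmin]] := eqVneq s [::].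
  by exists a => [|y]; rewrite inE// => /eqP->.
have [ax|xa] := leP (g a) (g x).
  exists a => [|y]; rewrite inE ?eqxx// => /predU1P[->//|/xmin].
  exact: le_trans.
exists x => [|y]; rewrite inE ?xs ?orbT// => /predU1P[->|/xmin//].
exact: ltW.
Qed.

(** * Polyhedral cones and their extreme rays *)

Lemma count_lt (T : eqType) (p q : pred T) (s : seq T) x :
    {in s, forall y, p y -> q y} -> x \in s -> q x -> ~~ p x ->
  (count p s < count q s)%N.
Proof.
move=> pq xs qx px.
have -> : count p s = count (predI p q) s.
  by apply: eq_in_count => y ys /=; case: (boolP (p y)) => // /(pq _ ys) ->.
rewrite -[X in (_ < X)%N]size_filter -(count_predC p) !count_filter.
rewrite -addn1 leq_add2l -has_count; apply/hasP; exists x => //=.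
by rewrite px qx.
Qed.

Section Cone.
Variables (R : realType) (d : nat) (b : seq 'cV[int]_d).
Implicit Types v w : 'cV[R]_d.

Definition in_cone w := forall x, x \in b -> 0 <= dotv w (intmx R x).

Definition tight w (x : 'cV[int]_d) := dotv w (intmx R x) == 0.

Definition tight_le v w := forall x, x \in b -> tight v x -> tight w x.

Definition extreme w :=
  [/\ in_cone w, w != 0 & forall v, in_cone v -> tight_le w v ->
                                    exists2 l, 0 <= l & v = l *: w].

(** Constraints tight at [w] stay tight along [v]; the finitely many others have positive slack at
    [w] and survive a small step. *)
Lemma in_cone_small v w : in_cone w -> tight_le w v ->
  exists2 e, 0 < e & in_cone (w + e *: v).
Proof.
move=> wN wv; pose s := [seq x <- b | ~~ tight w x].
have [s0|s0] := eqVneq s [::].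
  exists 1 => // x xb; rewrite dotvDl dotvZl.
  have wx : tight w x.
    by apply/negPn/negP => wx; have : x \in s by [rewrite mem_filter wx];
      rewrite s0.
  by rewrite (eqP wx) (eqP (wv _ xb wx)) mulr0 addr0.
(* Slack over rate of change; the added 1 keeps the denominator positive when [v] is orthogonal to
   [x]. *)
pose g x := dotv w (intmx R x) / (1 + `|dotv v (intmx R x)|).
have g1 x : 0 < 1 + `|dotv v (intmx R x)| by rewrite ltr_pwDl.
have [x0 x0s x0min] := seq_min g s0.
have : 0 < g x0.
  move: x0s; rewrite mem_filter => /andP[wx0 x0b].
  by rewrite divr_gt0// lt0r wx0 wN.
exists (g x0) => // x xb; rewrite dotvDl dotvZl.
have [wx|wx] := boolP (tight w x).
  by rewrite (eqP wx) (eqP (wv _ xb wx)) mulr0 addr0.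
have : g x0 <= g x by apply: x0min; rewrite mem_filter wx.
rewrite {2}/g ler_pdivlMr// => gx.
have := ler_norm (- dotv v (intmx R x)); rewrite normrN => vx.
have : g x0 * - dotv v (intmx R x) <= g x0 * `|dotv v (intmx R x)|.
  by rewrite ler_pM2l.
nra.
Qed.

(** The ratio test of linear programming: the largest multiple of [v] that can be subtracted from
    [w] without leaving the cone makes a new constraint tight. *)
Lemma cone_step v w : in_cone w -> in_cone v ->
    (exists2 x, x \in b & ~~ tight v x) ->
  exists2 l, 0 <= l & in_cone (w - l *: v) /\
    exists x, [/\ x \in b, ~~ tight v x & tight (w - l *: v) x].
Proof.
move=> wN vN [y yb vy]; pose s := [seq x <- b | ~~ tight v x].
have s0 : s != [::].
  by apply/eqP => s0; have : y \in s by [rewrite mem_filter vy]; rewrite s0.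
have vx x : x \in s -> 0 < dotv v (intmx R x).
  by rewrite mem_filter => /andP[vx xb]; rewrite lt0r vx vN.
pose g x := dotv w (intmx R x) / dotv v (intmx R x).
have [x0 x0s x0min] := seq_min g s0.
have x0b : x0 \in b by move: x0s; rewrite mem_filter => /andP[].
exists (g x0); first by rewrite divr_ge0// ?wN// ltW// vx.
split=> [x xb|].
  rewrite dotvBl dotvZl subr_ge0; have [/eqP->|nvx] := boolP (tight v x).
    by rewrite mulr0 wN.
  have xs : x \in s by rewrite mem_filter nvx.
  by rewrite -ler_pdivlMr ?vx// x0min.
exists x0; split=> //; first by move: x0s; rewrite mem_filter => /andP[].
by rewrite /tight dotvBl dotvZl divfK ?subrr// gt_eqF ?vx.
Qed.

Hypothesis pointed : forall w, (forall x, x \in b -> tight w x) -> w = 0.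

(** Minkowski's theorem that a pointed cone is generated by its extreme rays, put as an induction
    principle. The induction is on the number of constraints that are not tight. *)
Lemma cone_ind (P : 'cV[R]_d -> Prop) :
    P 0 -> (forall v w, P v -> P w -> P (v + w)) -> (forall w, extreme w -> P w) ->
  forall w, in_cone w -> P w.
Proof.
move=> P0 PD Pext w.
have [m] := ubnP (count (predC (tight w)) b).
elim: m w => // m IHm w; rewrite ltnS => le_m wN.
have [->//|w0] := eqVneq w 0.
have smaller v : in_cone v -> tight_le w v ->
    (exists x, [/\ x \in b, ~~ tight w x & tight v x]) -> P v.
  move=> vN wv [x [xb wx vx]]; apply: IHm => //; apply: leq_trans le_m.
  apply: (count_lt (x := x)) => //=; last by rewrite negbK.
  by move=> y yb; apply: contra; exact: wv.
have [wext|] := pselect (extreme w); first exact: Pext.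
move=> nwext.
have [v [vN wv nv]] : exists v, [/\ in_cone v, tight_le w v &
    ~ exists2 l, 0 <= l & v = l *: w].
  apply: contrapT => nv; apply: nwext; split=> // v vN wv.
  by apply: contrapT => nvl; apply: nv; exists v.
have ntight u : u != 0 -> exists2 x, x \in b & ~~ tight u x.
  move=> u0; apply: contrapT => nu; move/eqP: u0; apply; apply: pointed => x xb.
  by apply/negPn/negP => ux; apply: nu; exists x.
(* First [v] is pushed along [- w] to a point [v - l *: w] that is tight at a constraint slack at
   [w]. Then [w] is pushed along minus that point until another constraint becomes tight. So [w] is
   a sum of two points with fewer slack constraints each. *)
have [l l0 [v2N [x [xb wx v2x]]]] := cone_step vN wN (ntight _ w0).
have wv2 : tight_le w (v - l *: w).
  by move=> y yb wy; rewrite /tight dotvBl dotvZl (eqP wy) (eqP (wv _ yb wy))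
    mulr0 subr0.
have v2n0 : v - l *: w != 0.
  by apply/eqP => /subr0_eq vl; apply: nv; exists l.
have [r r0 [w3N [y [yb v2y w3y]]]] := cone_step wN v2N (ntight _ v2n0).
rewrite -(subrK (r *: (v - l *: w)) w); apply: PD.
  apply: smaller => //.
    by move=> z zb wz; rewrite /tight dotvBl dotvZl (eqP wz) (eqP (wv2 _ zb
      wz)) mulr0 subr0.
  by exists y; split=> //; apply: contra v2y => /(wv2 _ yb).
have rv2 z : z \in b -> tight (v - l *: w) z -> tight (r *: (v - l *: w)) z.
  by move=> zb vz; rewrite /tight dotvZl (eqP vz) mulr0.
apply: smaller.
- by move=> z zb; rewrite dotvZl mulr_ge0// v2N.
- by move=> z zb /(wv2 _ zb)/(rv2 _ zb).
- by exists x; split=> //; exact: rv2.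
Qed.

End Cone.

(** * Integral generators of extreme rays *)

Lemma intmx_inj (C : numDomainType) m n : injective (@intmx C m n).
Proof.
move=> A B AB; apply/matrixP => i j.
by have /matrixP/(_ i j) := AB; rewrite !mxE => /intr_inj.
Qed.

Lemma intmx0 (C : nzRingType) m n : intmx C (0 : 'M[int]_(m, n)) = 0.
Proof. exact: map_mx0. Qed.

Lemma rat_kernel_int (m d : nat) (A : 'M[int]_(d, m)) :
    kermx (intmx rat A) != 0 ->
  exists2 z : 'cV[int]_d, z != 0 & z^T *m A = 0.
Proof.
move=> /matrix0Pn[i [j0 qij]]; pose q := row i (kermx (intmx rat A)).
have qA : q *m intmx rat A = 0 by rewrite -row_mul mulmx_ker row0.
pose D : int := \prod_j denq (q 0 j).
have D0 : D != 0 by apply/prodf_neq0 => j _; exact: denq_neq0.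
(* [z] is [q] with its denominators cleared: its entries are those of [D *: q]. *)
pose z : 'cV[int]_d := \col_j (numq (q 0 j) * \prod_(l | l != j) denq (q 0 l)).
have zE : intmx rat z^T = D%:~R *: q.
  apply/rowP => j; rewrite [LHS]mxE [z^T _ _]mxE [z _ _]mxE [RHS]mxE.
  have -> : D = denq (q 0 j) * \prod_(l | l != j) denq (q 0 l) by rewrite /D
    (bigD1 j).
  rewrite !intrM mulrAC; congr (_ * _).
  by rewrite -[X in _ = _ * X]divq_num_den mulrCA divff ?intr_eq0 ?denq_neq0//
    mulr1.
exists z.
  apply/eqP => z0; move: zE; rewrite z0 trmx0 intmx0 => /rowP/(_ j0)/esym/eqP.
  rewrite [X in X == _]mxE [X in _ == X]mxE mulf_eq0 intr_eq0 (negPf D0) mxE.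
  by rewrite (negPf qij).
apply: (@intmx_inj rat).
by rewrite intmx0 intmxM zE -scalemxAl qA scaler0.
Qed.

Lemma primitive_multiple d (z : 'cV[int]_d) : z != 0 ->
  exists (g : nat) (rho : 'cV[int]_d),
    [/\ (0 < g)%N, primitive rho & z = g%:Z *: rho].
Proof.
move=> z0; pose g := \big[gcdn/0%N]_i absz (z i 0).
have gdvd i : (g %| absz (z i 0%R))%N by rewrite /g (bigD1 i)//= dvdn_gcdl.
have g0 : (0 < g)%N.
  rewrite lt0n; apply: contra z0 => /eqP g0; apply/eqP/colP => i; rewrite mxE.
  by apply/eqP; have := gdvd i; rewrite g0 dvd0n absz_eq0.
pose rho : 'cV[int]_d := \col_i (z i 0%R %/ g%:Z)%Z.
have zE : z = g%:Z *: rho.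
  by apply/colP => i; rewrite !mxE mulrC divzK// dvdzE absz_nat.
exists g, rho; split=> //; rewrite /primitive.
apply/eqP; rewrite -(eqn_pmul2l g0) muln1; apply/eqP.
rewrite {2}/g [in RHS]zE (big_morph (muln g) (muln_gcdr g) (muln0 g)).
by apply: eq_bigr => i _; rewrite !mxE abszM absz_nat.
Qed.

Section Rationality.
Variables (R : realType) (d : nat) (b : seq 'cV[int]_d).

(** Extremality speaks only of points of the cone; it is applied to [w + e *: v], which lies in the
    cone for small [e]. *)
Lemma extreme_line (w v : 'cV[R]_d) : extreme b w -> tight_le b w v ->
  exists l, v = l *: w.
Proof.
move=> [wN w0 wext] wv; have [e e0 ewN] := in_cone_small wN wv.
have [|l l0 lE] := wext _ ewN.
  move=> x xb wx; rewrite /tight dotvDl dotvZl (eqP wx) (eqP (wv _ xb wx)).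
  by rewrite mulr0 addr0.
exists (e^-1 * (l - 1)); apply: (scalerI (lt0r_neq0 e0)).
by rewrite scalerA mulVKf ?lt0r_neq0// scalerBl scale1r -lE addrC addKr.
Qed.

(** The constraints tight at [w] are integral and, by [extreme_line], their common kernel is the
    line of [w]; so this line contains an integral vector, which is made primitive and given the
    right sign. *)
Lemma extreme_integral (w : 'cV[R]_d) : extreme b w ->
  exists2 rho, primitive rho & exists2 l, 0 < l & w = l *: intmx R rho.
Proof.
move=> wext; have [wN w0 _] := wext.
pose s := [seq x <- b | tight w x].
pose A : 'M[int]_(d, size s) := \matrix_(i, j) (nth 0 s j) i 0.
have dotA (v : 'cV[R]_d) j : (v^T *m intmx R A) 0 j = dotv v (intmx R (nth 0 s j)).
  by rewrite !mxE; apply: eq_bigr => i _; rewrite !mxE.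
have kerR : kermx (intmx R A) != 0.
  apply: contra w0 => /eqP kA0; rewrite -trmx_eq0 -submx0 -kA0; apply/sub_kermxP.
  apply/rowP => j; rewrite dotA [RHS]mxE; apply/eqP.
  by have /(mem_nth 0) : (j < size s)%N by []; rewrite mem_filter => /andP[].
have kerQ : kermx (intmx rat A) != 0.
  apply: contra kerR => /eqP kA0.
  (* A kernel that vanishes over the rationals still vanishes over [R]. *)
  have -> : intmx R A = map_mx ratr (intmx rat A).
    by apply/matrixP => i j; rewrite !mxE ratr_int.
  by rewrite -map_kermx kA0 map_mx0.
have [z z0 zA] := rat_kernel_int kerQ.
have [g [rho [g0 prho zE]]] := primitive_multiple z0.
have gR0 : (g%:R : R) != 0 by rewrite pnatr_eq0 -lt0n.
have rhoN0 : intmx R rho != 0.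
  apply: contra z0 => /eqP r0; rewrite zE.
  have -> : rho = 0; last by rewrite scaler0.
  by apply: (@intmx_inj R); rewrite r0 intmx0.
have [c cE] : exists c, intmx R rho = c *: w.
  apply: extreme_line wext _ => x xb wx.
  have xs : x \in s by rewrite mem_filter wx.
  have jlt : (index x s < size s)%N by rewrite index_mem.
  have : intmx R z^T *m intmx R A = 0 by rewrite -intmxM zA intmx0.
  have -> : intmx R z^T = (g%:R *: intmx R rho)^T.
    by apply/rowP => j; rewrite zE !mxE intrM.
  move=> /rowP/(_ (Ordinal jlt)); rewrite dotA /= nth_index// dotvZl mxE => /eqP.
  by rewrite mulf_eq0 (negPf gR0).
have c0 : c != 0 by apply: contra rhoN0 => /eqP c0; rewrite cE c0 scale0r.
have [cpos|cneg] := ltP 0 c.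
  exists rho => //; exists c^-1; first by rewrite invr_gt0.
  by rewrite cE scalerA mulVf// scale1r.
have {}cneg : c < 0 by rewrite lt_neqAle c0.
exists (- rho).
  by rewrite /primitive -[RHS]prho; apply: eq_bigr => i _; rewrite mxE abszN.
exists (- c^-1); first by rewrite oppr_gt0 invr_lt0.
have -> : intmx R (- rho) = - intmx R rho by exact: map_mxN.
by rewrite cE scalerN scaleNr opprK scalerA mulVf// scale1r.
Qed.

End Rationality.

(** * Convex hulls and the normal fan *)

Section ConvexHull.
Variables (R : realType) (n : nat).
Implicit Types (A C : set 'cV[R]_n) (w : 'cV[R]_n).

Lemma convex_setP C :
  (forall x y (t : R), C x -> C y -> 0 <= t <= 1 ->
     C (t *: x + (1 - t) *: y)) ->
  @convex_set R 'cV[R]_n C.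
Proof.
move=> Cconv x y t; rewrite !inE => Cx Cy; apply: Cconv => //.
by rewrite ge0 le1.
Qed.

Lemma convex_setE C x y (t : R) : @convex_set R 'cV[R]_n C -> C x -> C y ->
  0 <= t <= 1 -> C (t *: x + (1 - t) *: y).
Proof.
move=> Cconv Cx Cy /andP[t0 t1];
  have t01 : Itv.spec (@Itv.num_sem _) (Itv.Real `[0%Z, 1%Z]) t.
  by rewrite /= /Itv.num_sem/= in_itv/= t0 t1 num_real.
have := @Cconv x y (Itv.mk t01) (mem_set Cx) (mem_set Cy).
by rewrite inE.
Qed.

Lemma conv_hull_convex A : @convex_set R 'cV[R]_n (conv_hull A).
Proof.
apply: convex_setP => x y t Ax Ay t01 C [Cconv AC].
by apply: convex_setE => //; [apply: Ax|apply: Ay].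
Qed.

Lemma convex_halfspace w (c : R) :
  @convex_set R 'cV[R]_n [set x | c <= dotv w x].
Proof.
apply: convex_setP => x y t /= cx cy /andP[t0 t1].
rewrite dotvDr !dotvZr -[c](subrK (t * c)) addrC.
have -> : c - t * c = (1 - t) * c by rewrite mulrBl mul1r.
by apply: lerD; apply: ler_wpM2l => //; rewrite subr_ge0.
Qed.

Lemma convex_affine (V : {vspace 'cV[R]_n}) x0 :
  @convex_set R 'cV[R]_n [set x | x - x0 \in V].
Proof.
apply: convex_setP => x y t /= xV yV _.
rewrite -[x0](subrK (t *: x0)) [_ - t *: x0 + _]addrC opprD addrACA -scalerBr.
rewrite -{2}[x0]scale1r -scalerBl -scalerBr.
by apply: memvD; exact: memvZ.
Qed.

Lemma conv_hull_ge A w (c : R) : (forall x, A x -> c <= dotv w x) ->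
  forall x, conv_hull A x -> c <= dotv w x.
Proof.
by move=> Ac x; apply: (smallest_sub (@convex_halfspace w c)) => y /Ac.
Qed.

Lemma convex_translate C x0 (l : R) : @convex_set R 'cV[R]_n C ->
  @convex_set R 'cV[R]_n [set y | C (x0 + l *: y)].
Proof.
move=> Cconv; apply: convex_setP => x y t /= Cx Cy t01.
have -> : x0 + l *: (t *: x + (1 - t) *: y) =
    t *: (x0 + l *: x) + (1 - t) *: (x0 + l *: y).
  rewrite !scalerDr addrACA -scalerDl (addrC t) subrK scale1r !scalerA.
  by rewrite ![l * _]mulrC.
exact: convex_setE.
Qed.

Lemma convex_sum C (T : eqType) (r : seq T) (l : T -> R) (g : T -> 'cV[R]_n) :
    @convex_set R 'cV[R]_n C -> (forall m, m \in r -> 0 <= l m) ->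
    (forall m, m \in r -> C (g m)) -> \sum_(m <- r) l m = 1 ->
  C (\sum_(m <- r) l m *: g m).
Proof.
(* Dividing by the sum of the coefficients gives a statement that needs only a positive sum, and can
   be proved by induction on the list. *)
move=> Cconv l0 Cg l1; rewrite -[X in C X]scale1r -{1}invr1 -l1.
have : 0 < \sum_(m <- r) l m by rewrite l1.
elim: r l0 Cg {l1} => [|a r IHr] l0 Cg; first by rewrite big_nil ltxx.
rewrite !big_cons; set t := \sum_(m <- r) l m.
have lr m : m \in r -> 0 <= l m by move=> mr; rewrite l0// inE mr orbT.
have la : 0 <= l a by rewrite l0// mem_head.
have : 0 <= t by rewrite /t big_seq sumr_ge0.
rewrite le_eqVlt => /predU1P[t0|t0] lat.
  rewrite -t0 addr0 in lat *; rewrite big_seq big1 => [|m mr].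
    by rewrite addr0 scalerA mulVf ?gt_eqF// scale1r; apply: Cg; rewrite mem_head.
  have /eqP := esym t0; rewrite /t big_seq psumr_eq0// => /allP/(_ m mr).
  by rewrite mr => /eqP ->; rewrite scale0r.
have Cr : C (t^-1 *: \sum_(m <- r) l m *: g m).
  by apply: IHr => // m mr; apply: Cg; rewrite inE mr orbT.
have Ca : C (g a) by apply: Cg; rewrite mem_head.
have := @convex_setE C _ _ (l a / (l a + t)) Cconv Ca Cr.
rewrite divr_ge0 ?(ltW lat)// ler_pdivrMr// mul1r lerDl (ltW t0) => /(_ isT).
have -> : 1 - l a / (l a + t) = t / (l a + t).
  by rewrite -[1](@divff _ (l a + t)) ?gt_eqF// -mulrBl addrC addKr.
by rewrite !scalerA mulrAC divff ?gt_eqF// mul1r scalerDr scalerA mulrC.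
Qed.

End ConvexHull.

(** The points [q i] are replaced one index at a time: with the others fixed, the positions of [q i]
    that put the sum in [C] form a convex set, so it is enough that this set contains [A i]. *)
Lemma convex_minkowski (R : realType) n k (s : 'I_k -> R)
    (A : 'I_k -> set 'cV[R]_n) (C : set 'cV[R]_n) :
    @convex_set R 'cV[R]_n C ->
    (forall p, (forall i, A i (p i)) -> C (\sum_i s i *: p i)) ->
  forall q, (forall i, conv_hull (A i) (q i)) -> C (\sum_i s i *: q i).
Proof.
move=> Cconv CA q qA.
(* Invariant of the induction: the indices outside the list already have their point in [A i]. *)
have : forall i, i \notin enum 'I_k -> A i (q i) by move=> i; rewrite mem_enum.
elim: (enum 'I_k) q qA => [|a l IHl] q qA qAl; first by apply: CA => i; exact: qAl.
pose q' y i := if i == a then y else q i.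
have q'E y : \sum_i s i *: q' y i = \sum_(i | i != a) s i *: q i + s a *: y.
  rewrite (bigD1 a)//= addrC {2}/q' eqxx; congr (_ + _).
  by apply: eq_bigr => i /negPf ia; rewrite /q' ia.
suff : C (\sum_i s i *: q' (q a) i).
  by congr C; apply: eq_bigr => i _; rewrite /q'; case: eqP => // ->.
rewrite q'E.
have Dconv := @convex_translate _ _ _ (\sum_(i | i != a) s i *: q i) (s a) Cconv.
apply: (smallest_sub Dconv _ (qA a)) => y Ay /=.
rewrite -q'E; apply: IHl => i; rewrite /q'; case: eqP => [->|/eqP ia] //.
- exact: sub_gen_smallest.
- by move=> il; apply: qAl; rewrite inE negb_or il andbT.
Qed.

(** * The normal fan of a full-dimensional Minkowski sum *)

Section Fan.
Variables (R : realType) (d k : nat) (f : 'I_k -> laurent R d).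
Variables (F : 'M[int]_(d, d + k)) (a : 'M[int]_(k, d + k)).
Let P := minkowski_sum (fun i => newton (f i)).
Let M := col_mx F a.
Hypothesis dimP : has_dim P d.

Let sub_newton i m : m \in finsupp (f i) -> newton (f i) (intmx R m).
Proof. by move=> mi; apply: sub_gen_smallest; exists m. Qed.

(** The hull of the empty set is empty, whereas [P], having a dimension, is not. *)
Lemma finsupp_neq0 i : exists m, m \in finsupp (f i).
Proof.
have [[_ [q qP _]] _] := dimP.
have [E0|/fset0Pn//] := eqVneq (finsupp (f i)) fset0.
have conv0 : @convex_set R 'cV[R]_d set0 by move=> x y t; rewrite inE.
suff : set0 (q i) by [].
by apply: (smallest_sub conv0 _ (qP i)) => _ [m + <-]; rewrite /= E0.
Qed.

(** A difference of two points of [P] is a sum of differences inside the single Newton polytopes, so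
    [V] contains the direction space of [P], which is the whole space. *)
Lemma span_differences (V : {vspace 'cV[R]_d}) :
    (forall i m m', m \in finsupp (f i) -> m' \in finsupp (f i) ->
       intmx R (m - m') \in V) ->
  forall x, x \in V.
Proof.
move=> EV; have [_ [V0 [dimV0 _ V0min]]] := dimP.
have newtonV i x : newton (f i) x -> forall m, m \in finsupp (f i) ->
    x - intmx R m \in V.
  move=> xP m mi; apply: (smallest_sub (@convex_affine _ _ V (intmx R m)) _ xP).
  by move=> _ [m' m'i <-] /=; rewrite -intmxB; exact: (EV i).
have /subvP V0V : (V0 <= V)%VS.
  apply: V0min => _ _ [q qP ->] [q' q'P ->]; rewrite -sumrB;
    apply: memv_suml => i _.
  have [m mi] := finsupp_neq0 i.
  have -> : q i - q' i = (q i - intmx R m) - (q' i - intmx R m).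
    by rewrite opprB addrA subrK.
  by apply: memvB; [exact: newtonV (qP i) _ mi|exact: newtonV (q'P i) _ mi].
have V0f : V0 = fullv.
  by apply/eqP; rewrite -dimv_leqif_eq ?subvf// dimV0 dimvf /dim/= muln1.
by move=> x; apply: V0V; rewrite V0f memvf.
Qed.

(** The hyperplane orthogonal to [w] satisfies [span_differences], hence contains [w] itself. This
    makes the cones below pointed. *)
Lemma const_newton_eq0 (w : 'cV[R]_d) :
    (forall i m m', m \in finsupp (f i) -> m' \in finsupp (f i) ->
       dotv w (intmx R (m - m')) = 0) ->
  w = 0.
Proof.
move=> wE; pose h : 'Hom('cV[R]_d, 'M[R]_1) := linfun (mulmx w^T).
have hE x : (x \in lker h) = (dotv w x == 0).
  rewrite memv_ker lfunE /= dotvE; apply/eqP/eqP => [->|wx0]; first by rewrite mxE.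
  by apply/matrixP => i j; rewrite !ord1 wx0 mxE.
apply: dotvv_eq0; apply/eqP; rewrite -hE; apply: span_differences => i m m' mi m'i.
by rewrite hE; apply/eqP; exact: wE mi m'i.
Qed.

Hypothesis rayF : is_ray_matrix P F.
Hypothesis suppF : support_matrix f F a.

Lemma eta_ge0 i m j : m \in finsupp (f i) -> 0 <= Defs.eta F (row i a)^T m j 0.
Proof.
move=> mi; have [_ amin] := suppF i j.
have : - (a i j)%:~R <= dotv (intmx R (col j F)) (intmx R m).
  by apply: amin; exists (intmx R m) => //; exact: sub_newton.
have -> : dotv (intmx R (col j F)) (intmx R m) = ((F^T *m m) j 0)%:~R.
  rewrite !mxE rmorph_sum; apply: eq_bigr => l _; rewrite !mxE rmorphM//.
by rewrite -subr_ge0 opprK -intrD ler0z !mxE.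
Qed.

Section Minimizer.
Variable mm : 'I_k -> 'cV[int]_d.
Hypothesis mmE : forall i, mm i \in finsupp (f i).

(** The cone cut out by [b] is the normal cone of [P] at the point [v] below, the sum of the
    [mm i]. *)
Let b := flatten [seq [seq m - mm i | m <- finsupp (f i)] | i <- enum 'I_k].

Let bP x : reflect (exists i m, m \in finsupp (f i) /\ x = m - mm i) (x \in b).
Proof.
apply: (iffP flatten_mapP) => [[i _ /mapP[m mi ->]]|[i [m [mi ->]]]].
  by exists i, m.
by exists i; rewrite ?mem_enum//; apply: map_f.
Qed.

Let in_coneP w : in_cone b w <-> forall i m, m \in finsupp (f i) ->
  dotv w (intmx R (mm i)) <= dotv w (intmx R m).
Proof.
split=> [wN i m mi|wmin x /bP[i [m [mi ->]]]].
  by rewrite -subr_ge0 -dotvBr -intmxB; apply: wN; apply/bP; exists i, m.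
by rewrite intmxB dotvBr subr_ge0 wmin.
Qed.

Let pointed (w : 'cV[R]_d) : (forall x, x \in b -> tight w x) -> w = 0.
Proof.
move=> wb; have wm i m : m \in finsupp (f i) -> dotv w (intmx R (m - mm i)) = 0.
  by move=> mi; apply/eqP/wb/bP; exists i, m.
apply: const_newton_eq0 => i m m' mi m'i.
have -> : m - m' = (m - mm i) - (m' - mm i) by rewrite opprB addrA subrK.
by rewrite intmxB dotvBr !wm// subrr.
Qed.

Let v := \sum_i intmx R (mm i).

Let vP x : x \in b -> P (v + intmx R x).
Proof.
move=> /bP[i [m [mi ->]]].
exists (fun l => intmx R (if l == i then m else mm l)).
  by move=> l; apply: sub_newton; case: eqP => // ->.
rewrite /v (bigD1 i)//= [in RHS](bigD1 i)//= eqxx intmxB addrAC [intmx R m -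
  _]addrC addrA.
rewrite addrN add0r; congr (_ + _); apply: eq_bigr => l /negPf -> //.
Qed.

Let PvP : P v.
Proof. by exists (fun i => intmx R (mm i)) => // i; apply: sub_newton. Qed.

Let vmin w y : in_cone b w -> P y -> dotv w v <= dotv w y.
Proof.
move=> /in_coneP wmin [q qP ->]; rewrite !dotv_sumr; apply: ler_sum => i _.
by apply: (conv_hull_ge _ (qP i)) => _ [m mi <-]; exact: wmin.
Qed.

(** The half-line of [w] is the normal cone of a face, namely of the face of [P] on which [w] is
    minimal; [extreme_integral] provides its primitive generator. *)
Lemma extreme_is_ray w : extreme b w ->
  exists2 l : R, 0 < l & exists j, w = l *: intmx R (col j F).
Proof.
move=> wext; have [wN w0 wmin] := wext.
have [rho prho [l l0 wE]] := extreme_integral wext.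
exists l => //; suff /rayF.2[j rhoE] : is_ray_generator P rho by exists j;
  rewrite -rhoE.
split=> //; pose Q := [set x | P x /\ forall y, P y -> dotv w x <= dotv w y].
have Qv : Q v by split=> // y; exact: vmin.
exists Q; first by split; [exists v|exists w].
apply/seteqP; split=> [u uQ|_ [c c0 <-]]; last first.
  move=> x y [Px xmin] Py; have := xmin y Py.
  rewrite wE !dotvZl ler_pM2l// => xy.
  exact: ler_wpM2l.
(* When [w] is tight at [x], both [v] and [v + x] lie on the face [Q], so [u] takes equal values
   there and is tight at [x] too; extremality of [w] applies to [u]. *)
have [|x xb|c c0 uE] := wmin u.
- move=> x xb; have := uQ v _ Qv (vP xb).
  by rewrite dotvDr lerDl.
- rewrite /tight => wx.
  have Qvx : Q (v + intmx R x).
    split=> [|y Py]; first exact: vP.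
    by rewrite dotvDr (eqP wx) addr0 vmin.
  have := uQ _ _ Qvx PvP; have := uQ v _ Qv (vP xb); rewrite dotvDr lerDl gerDl.
  by rewrite eq_le => -> ->.
by exists (c * l); rewrite /= ?mulr_ge0 ?(ltW l0)// -scalerA -wE.
Qed.

Hypothesis unitM : M \in unitmx.

(* [w] is a nonnegative combination of the rays [rho_j] on whose cone the
   support functions of the [P_i] are linear; its coefficients are forced to be
   those displayed here. *)
Lemma fan_complete w :
    (forall i m, m \in finsupp (f i) ->
       dotv w (intmx R (mm i)) <= dotv w (intmx R m)) ->
  forall j, 0 <= (intmx R (invmx M) *m
                  col_mx w (\col_i - dotv w (intmx R (mm i)))) j 0.
Proof.
move=> /in_coneP; move: w; apply: cone_ind.
- exact: pointed.
- move=> j; rewrite (_ : col_mx _ _ = 0) ?mulmx0 ?mxE//.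
  rewrite -[RHS]col_mx0; congr col_mx.
  by apply/colP => i; rewrite !mxE dotv0l oppr0.
- move=> u w Hu Hw j.
  rewrite (_ : col_mx _ _ = col_mx u (\col_i - dotv u (intmx R (mm i))) +
                          col_mx w (\col_i - dotv w (intmx R (mm i)))).
    by rewrite mulmxDr mxE addr_ge0.
  rewrite add_col_mx; congr col_mx; apply/colP => i.
  by rewrite !mxE dotvDl opprD.
move=> w wext j; have [l l0 [j' wE]] := extreme_is_ray wext.
have [/in_coneP wmin _ _] := wext.
(* The minimum of a ray generator over [P_i] is minus an entry of [a], so for an extreme [w] this
   vector is a positive multiple of a column of [M], and [M^-1] sends it to a multiple of a basis
   vector. *)
have -> : col_mx w (\col_i - dotv w (intmx R (mm i))) = l *: intmx R (col j' M).
  rewrite /M col_col_mx [intmx R (col_mx _ _)]map_col_mx scale_col_mx -wE;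
    congr col_mx.
  apply/colP => i; rewrite !mxE wE dotvZl -mulrN; congr (_ * _).
  have [[q qP qE] amin] := suppF i j'.
  apply/eqP; rewrite eqr_oppLR eq_le; apply/andP; split.
    rewrite -qE; apply: (conv_hull_ge _ qP) => _ [m mi <-].
    by have := wmin i m mi; rewrite wE !dotvZl ler_pM2l.
  by apply: amin; exists (intmx R (mm i)) => //; exact: sub_newton.
rewrite -scalemxAr -intmxM colE mulmxA mulVmx// mul1mx mxE mulr_ge0 ?(ltW l0)//.
by rewrite !mxE; case: eqP.
Qed.

End Minimizer.
End Fan.

(** * Monomials and limits *)

Section Monomials.
Variable C : fieldType.

Lemma monomial_neq0 n (u : 'cV[C]_n) e : torus u -> monomial u e != 0.
Proof. by move=> u0; apply/prodf_neq0 => j _; rewrite expfz_neq0. Qed.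

Lemma monomial_map_torus p q (B : 'M[int]_(p, q)) (t : 'cV[C]_p) :
  torus t -> torus (monomial_map B t).
Proof. by move=> t0 j; rewrite mxE monomial_neq0. Qed.

Lemma exprz_prod I (r : seq I) (g : I -> C) (z : int) :
  (\prod_(i <- r) g i) ^ z = \prod_(i <- r) g i ^ z.
Proof.
by apply: (big_morph (fun x : C => x ^ z)) => [x y|]; rewrite ?expfzMl ?exp1rz.
Qed.

Lemma exprz_sum I (r : seq I) (x : C) (z : I -> int) : x != 0 ->
  x ^ (\sum_(i <- r) z i) = \prod_(i <- r) x ^ z i.
Proof.
move=> x0; apply: (big_morph (fun m : int => x ^ m)) => [i j|];
  last by rewrite expr0z.
exact: expfzDr.
Qed.

Lemma monomial_comp p q (B : 'M[int]_(p, q)) (t : 'cV[C]_p) e : torus t ->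
  monomial (monomial_map B t) e = monomial t (B *m e).
Proof.
move=> t0; rewrite /monomial; under eq_bigr do rewrite mxE exprz_prod.
rewrite exchange_big; apply: eq_bigr => i _; rewrite mxE exprz_sum//.
by apply: eq_bigr => j _; rewrite exprz_exp mxE.
Qed.

Lemma monomial_map_comp p q r (A : 'M[int]_(p, q)) (B : 'M[int]_(q, r))
  (t : 'cV[C]_p) : torus t ->
  monomial_map B (monomial_map A t) = monomial_map (A *m B) t.
Proof.
move=> t0; apply/colP => j; rewrite ![LHS]mxE ![RHS]mxE monomial_comp//.
by rewrite !colE mulmxA.
Qed.

Lemma monomial_delta n (t : 'cV[C]_n) i : monomial t (delta_mx i 0) = t i 0.
Proof.
rewrite /monomial (bigD1 i)//= mxE !eqxx /= expr1z big1 ?mulr1// => j ji.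
by rewrite mxE (negPf ji) expr0z.
Qed.

Lemma monomial_map1 n (t : 'cV[C]_n) : monomial_map 1%:M t = t.
Proof. by apply/colP => j; rewrite mxE col1 monomial_delta. Qed.

Lemma monomialD n (t : 'cV[C]_n) e e' : torus t ->
  monomial t (e + e') = monomial t e * monomial t e'.
Proof.
move=> t0; rewrite /monomial -big_split; apply: eq_bigr => j _ /=.
by rewrite mxE expfzDr.
Qed.

Lemma monomial_col_mx p q (t : 'cV[C]_p) (u : 'cV[C]_q) e e' :
  monomial (col_mx t u) (col_mx e e') = monomial t e * monomial u e'.
Proof.
rewrite /monomial big_split_ord /=; congr (_ * _); apply: eq_bigr => j _.
  by rewrite !col_mxEu.
by rewrite !col_mxEd.
Qed.

Lemma monomial_map_row_mx p q r (A : 'M[int]_(p, q)) (B : 'M[int]_(p, r))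
  (t : 'cV[C]_p) :
  monomial_map (row_mx A B) t = col_mx (monomial_map A t) (monomial_map B t).
Proof.
apply/colP => j; rewrite mxE; case: (split_ordP j) => l ->.
  by rewrite col_mxEu mxE colKl.
by rewrite col_mxEd mxE colKr.
Qed.

Lemma torus_col_mx p q (t : 'cV[C]_p) (u : 'cV[C]_q) :
  torus t -> torus u -> torus (col_mx t u).
Proof.
by move=> t0 u0 j; case: (split_ordP j) => l ->; rewrite ?col_mxEu ?col_mxEd.
Qed.

End Monomials.

Lemma monomial_morph (C C' : fieldType) (h : {rmorphism C -> C'}) n
  (u : 'cV[C]_n) e : monomial (map_mx h u) e = h (monomial u e).
Proof. by rewrite rmorph_prod; apply: eq_bigr => j _; rewrite mxE fmorphXz. Qed.

Section Limits.
Variables (K : numFieldType) (T : Type).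

Lemma cvg_big_sum (G : set_system T) {FG : Filter G} (I : eqType) (r : seq I)
    (g : I -> T -> K) (l : I -> K) :
  (forall i, i \in r -> g i x @[x --> G] --> l i) ->
  (\sum_(i <- r) g i x) @[x --> G] --> \sum_(i <- r) l i.
Proof.
elim: r => [|i r IHr] gl.
  by under eq_fun do rewrite big_nil; rewrite big_nil; exact: cvg_cst.
under eq_fun do rewrite big_cons; rewrite big_cons; apply: cvgD.
  by apply: gl; rewrite mem_head.
by apply: IHr => j jr; apply: gl; rewrite inE jr orbT.
Qed.

Lemma cvg_big_prod (G : set_system T) {FG : Filter G} I (r : seq I) (g : I -> T
  -> K) (l : I -> K) :
  (forall i, g i x @[x --> G] --> l i) ->
  (\prod_(i <- r) g i x) @[x --> G] --> \prod_(i <- r) l i.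
Proof.
move=> gl; elim: r => [|i r IHr].
  by under eq_fun do rewrite big_nil; rewrite big_nil; exact: cvg_cst.
by under eq_fun do rewrite big_cons; rewrite big_cons; exact: cvgM.
Qed.

Lemma cvg_mx (G : set_system T) {FG : Filter G} (X : topologicalType) m n
  (g : T -> 'M[X]_(m, n)) (A : 'M[X]_(m, n)) :
  (forall i j, g x i j @[x --> G] --> A i j) -> g x @[x --> G] --> A.
Proof.
move=> gA P [Q AQ QP]; rewrite nbhs_simpl /=.
have : \forall x \near G, forall i j, Q i j (g x i j).
  by apply: filter_forall => i; apply: filter_forall => j; exact: gA (AQ i j).
by apply: filterS => x /QP.
Qed.

End Limits.

Section Continuity.
Variables (K : numFieldType) (n : nat).

Lemma monomial_continuous (e : 'cV[int]_n) : (forall j, 0 <= e j 0) ->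
  continuous (fun u : 'cV[K]_n => monomial u e).
Proof.
move=> e0 u; apply: (@cvg_big_prod K _ (nbhs u) _) => j.
have -> : e j 0 = Posz (absz (e j 0)) by rewrite gez0_abs.
have := @coord_continuous K n 1 j 0 u.
elim: (absz (e j 0)) => [|m IHm] uj; first by under eq_fun do rewrite expr0z;
  exact: cvg_cst.
under eq_fun do rewrite exprSz; rewrite exprSz.
by apply: cvgM; [exact: uj|exact: IHm].
Qed.

End Continuity.

(** Within the image, the preimage by [g] of a closed set [D] is the image by [h] of the compact set
    [A] meets [D]; it is compact, hence closed. *)
Lemma compact_injective_inverse (X Y : topologicalType) (A : set X) (h : X -> Y)
    (g : Y -> X) :
    compact A -> hausdorff_space Y -> {within A, continuous h} ->
    {in A, cancel h g} ->
  {within h @` A, continuous g}.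
Proof.
move=> Acpt hY hc hK; apply/continuous_closedP => D Dcl.
apply/closed_subspaceP; exists (h @` (A `&` D)).
  apply: compact_closed => //; apply: continuous_compact.
    by apply: continuous_subspaceW hc; exact: subIsetl.
  exact: compact_closedI.
apply/seteqP; split=> [_ [[x [Ax Dx] <-] _]|y [Dy [x Ax xy]]] /=.
  by split; [change (D (g (h x))); rewrite hK ?inE|exists x].
change (D (g y)) in Dy; move: Dy; rewrite -xy hK ?inE// => Dx.
by split; exists x.
Qed.

Lemma trmx_continuous (X : topologicalType) m n :
  continuous (fun u : 'M[X]_(m, n) => u^T).
Proof.
move=> u; apply: (@cvg_mx _ (nbhs u) _) => i j; rewrite mxE => Q uQ;
  exists (fun k l => if (k == j) && (l == i) then Q else setT).
  move=> k l; case: ifPn => [/andP[/eqP -> /eqP ->]//|_]; exact: filterT.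
by move=> v /(_ j i); rewrite !eqxx/= mxE.
Qed.

Lemma cV_compact (X : ptopologicalType) n (A : 'I_n -> set X) :
  (forall i, compact (A i)) -> compact [set v : 'cV[X]_n | forall i, A i (v i 0)].
Proof.
move=> Acpt; have := rV_compact Acpt => /(continuous_compact _).
move=> /(_ _ _ (continuous_subspaceT (@trmx_continuous X 1 n))).
congr compact; apply/seteqP; split=> [_ [v Av <-] i|v Av]; first by rewrite mxE.
by exists v^T; rewrite ?trmxK// => i /=; rewrite mxE.
Qed.

Section PowR.
Variable R : realType.

(** The norm gives a function continuous on the whole line, including 0, where boundary points of
    the chart are evaluated. For [x = 0] it is constantly 1. *)
Lemma powR_norm_continuous (x : R) : 0 <= x -> continuous (fun t : R => `|t| `^ x).
Proof.
rewrite le_eqVlt => /predU1P[<- t|x0 t].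
  by under eq_fun do rewrite powRr0; exact: cst_continuous.
have [->|t0] := eqVneq t 0.
  rewrite /continuous_at /= normr0 powR0 ?gt_eqF//; apply/cvgrPdist_lt => e e0.
  near=> z; rewrite sub0r normrN ger0_norm ?powR_ge0//.
  have -> : e = (e `^ (x^-1)) `^ x by rewrite -powRrM mulVf ?gt_eqF// powRr1// ltW.
  apply: gt0_ltr_powR => //; rewrite ?nnegrE ?powR_ge0//.
  near: z; apply/nbhs_ballP; exists (e `^ x^-1); first by rewrite /= powR_gt0.
  by move=> z; rewrite /ball/= sub0r normrN.
have pn : 0 < `|t| by rewrite normr_gt0.
apply: (@continuous_comp _ _ _ (fun t : R => `|t|) (fun t => t `^ x)).
  exact: norm_continuous.
apply: differentiable_continuous; apply/derivable1_diffP.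
by apply: derivable_powR; rewrite in_itv/= pn.
Unshelve. all: by end_near. Qed.

End PowR.

(** * The nonnegative part of the chart *)

Lemma expR_intz (R : realType) (z : int) (x : R) : expR (z%:~R * x) = expR x ^ z.
Proof.
case: z => m; first exact: expRM_natl.
by rewrite NegzE rmorphN mulNr expRN; congr _^-1; exact: expRM_natl.
Qed.

Lemma ge0_at0 (R : realType) (q : R -> R) :
  {for 0, continuous q} -> (forall t, 0 < t -> 0 <= q t) -> 0 <= q 0.
Proof.
move=> qc qpos; apply: (cvgr_to_ge (cvg_at_right_filter qc)).
by near=> t; apply: qpos; near: t; exact: nbhs_right_gt.
Unshelve. all: by end_near. Qed.

Section Twist.
Variables (R : realType) (n : nat).
Implicit Types (u : 'cV[R]_n) (z : 'cV[R]_n) (e : 'cV[int]_n).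

(** Translation by [z] in the coordinates [ln u], in a form that still makes sense on the boundary:
    zero coordinates stay zero. *)
Definition twist u z : 'cV[R]_n := \col_j (u j 0 * expR (z j 0)).

Lemma twistE u z j : twist u z j 0 = u j 0 * expR (z j 0).
Proof. by rewrite mxE. Qed.

Lemma monomial_twist u z e :
  monomial (twist u z) e = monomial u e * expR (dotv (intmx R e) z).
Proof.
rewrite expR_sum -big_split; apply: eq_bigr => j _ /=.
by rewrite !mxE expfzMl expR_intz.
Qed.

Lemma twist_ge0 u z : (forall j, 0 <= u j 0) -> forall j, 0 <= twist u z j 0.
Proof. by move=> u0 j; rewrite mxE mulr_ge0// expR_ge0. Qed.

Lemma monomial_ge0 u e : (forall j, 0 <= u j 0) -> 0 <= monomial u e.
Proof. by move=> u0; apply: prodr_ge0 => j _; rewrite exprz_ge0. Qed.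

Lemma monomial_eq0 u e : (forall j, 0 <= e j 0) ->
  (monomial u e == 0) = [exists j, (u j 0 == 0) && (e j 0 != 0)].
Proof.
move=> e0; apply/prodf_eq0/existsP => [[j _]|[j /andP[uj ej]]].
  by rewrite expfz_eq0 => /andP[ej uj]; exists j; rewrite uj ej.
by exists j; rewrite // expfz_eq0 ej uj.
Qed.

End Twist.

Section Chart.
Variables (R : realType) (d n k : nat) (E : 'I_k -> {fset 'cV[int]_d}).
Variables (c : 'I_k -> 'cV[int]_d -> R) (e : 'I_k -> 'cV[int]_d -> 'cV[int]_n).
Variables (K : 'M[int]_(n, k)) (s : 'cV[R]_k).
Hypothesis c_gt0 : forall i m, m \in E i -> 0 < c i m.
Hypothesis E_neq0 : forall i, exists m, m \in E i.
Hypothesis e_ge0 : forall i m j, m \in E i -> 0 <= e i m j 0.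
Hypothesis e_deg : forall i m, K^T *m e i m = delta_mx i 0.
(** The completeness of the fan enters the study of the real chart only through this inequality. *)
Hypothesis complete : forall (z : 'cV[R]_n) (mm : 'I_k -> 'cV[int]_d),
  (forall i, mm i \in E i) ->
  (forall i m, m \in E i ->
     dotv (intmx R (e i (mm i))) z <= dotv (intmx R (e i m)) z) ->
  forall j, (intmx R K *m \col_i dotv (intmx R (e i (mm i))) z) j 0 <= z j 0.
Hypothesis s_gt0 : forall i, 0 < s i 0.
Implicit Types u w z x : 'cV[R]_n.

Definition weight i m u := c i m * monomial u (e i m).

Definition chart_poly i u := \sum_(m <- E i) weight i m u.

Definition real_chart : set 'cV[R]_n :=
  [set u : 'cV[R]_n | (forall j, 0 <= u j 0) /\ forall i, chart_poly i u = 1].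

Definition real_moment u : 'cV[R]_n :=
  \sum_i s i 0 *: \sum_(m <- E i) weight i m u *: intmx R (e i m).

Definition moment_polytope : set 'cV[R]_n :=
  [set x : 'cV[R]_n | (intmx R K)^T *m x = s /\ forall j, 0 <= x j 0].

Lemma weight_ge0 i m u : (forall j, 0 <= u j 0) -> m \in E i -> 0 <= weight i m u.
Proof. by move=> u0 mi; rewrite mulr_ge0 ?monomial_ge0 ?(ltW (c_gt0 mi)). Qed.

Lemma weight_eq0 i m u : m \in E i -> (weight i m u == 0) = (monomial u (e i m)
  == 0).
Proof. by move=> mi; rewrite mulf_eq0 gt_eqF ?c_gt0. Qed.

Lemma weight_le_chart_poly i m u : (forall j, 0 <= u j 0) -> m \in E i ->
  weight i m u <= chart_poly i u.
Proof.
move=> u0 mi; rewrite /chart_poly (big_rem m)//= lerDl big_seq sumr_ge0// => m' m'i.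
by apply: weight_ge0 => //; exact: mem_rem m'i.
Qed.

Lemma weight_twist i m u z :
  weight i m (twist u z) = weight i m u * expR (dotv (intmx R (e i m)) z).
Proof. by rewrite /weight monomial_twist mulrA. Qed.

Lemma chart_poly_neq0 i u : chart_poly i u != 0 -> exists2 m, m \in E i &
  monomial u (e i m) != 0.
Proof.
move=> hi; apply: contrapT => nm; move/eqP: hi; apply.
rewrite /chart_poly big_seq big1// => m mi; apply/eqP; rewrite weight_eq0//.
by apply/negPn/negP => um; apply: nm; exists m.
Qed.

Lemma chart_poly_gt0 i u : (forall j, 0 < u j 0) -> 0 < chart_poly i u.
Proof.
move=> u0; have [m mi] := E_neq0 i.
apply: lt_le_trans (weight_le_chart_poly _ mi) => [|j]; last exact/ltW.
rewrite mulr_gt0 ?c_gt0// lt0r monomial_ge0 => [|j]; last exact/ltW.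
by rewrite andbT monomial_neq0// => j; rewrite gt_eqF.
Qed.

Lemma dotv_moment u z : dotv (real_moment u) z =
  \sum_i s i 0 * \sum_(m <- E i) weight i m u * dotv (intmx R (e i m)) z.
Proof.
rewrite dotvC dotv_sumr; apply: eq_bigr => i _; rewrite dotvZr dotv_sumr.
by congr (_ * _); apply: eq_bigr => m _; rewrite dotvZr dotvC.
Qed.

Lemma momentE u j : real_moment u j 0 =
  \sum_i s i 0 * \sum_(m <- E i) weight i m u * (e i m j 0)%:~R.
Proof.
rewrite -dotv_delta dotv_moment; apply: eq_bigr => i _; congr (_ * _).
by apply: eq_bigr => m _; rewrite dotv_delta mxE.
Qed.

(** Consequently a twist by [K h] multiplies [chart_poly i] by [expR (h i 0)]. *)
Lemma dotv_deg i m (h : 'cV[R]_k) :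
  dotv (intmx R (e i m)) (intmx R K *m h) = h i 0.
Proof.
rewrite dotvE mulmxA -{1}(trmxK (intmx R K)) -trmx_mul.
have -> : (intmx R K)^T *m intmx R (e i m) = intmx R (delta_mx i 0).
  by rewrite -(e_deg i m) intmxM intmx_tr.
rewrite mxE (bigD1 i)//= !mxE !eqxx mul1r big1 ?addr0// => l li.
by rewrite !mxE (negPf li) mul0r.
Qed.

(* [chart_poly i] is homogeneous of degree [e_i] for the action of the torus
   (R_{>0})^k on R^n whose weights are the rows of [K]. *)
Definition normalize u := twist u (intmx R K *m \col_i - ln (chart_poly i u)).

Lemma chart_poly_normalize i u : 0 < chart_poly i u -> chart_poly i (normalize
  u) = 1.
Proof.
move=> hi; rewrite {1}/chart_poly;
  under eq_bigr do rewrite weight_twist dotv_deg mxE.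
by rewrite -mulr_suml -/(chart_poly i u) expRN lnK ?posrE// mulfV// gt_eqF.
Qed.

Lemma normalize_chart u : (forall j, 0 <= u j 0) -> (forall i, 0 < chart_poly i
  u) ->
  real_chart (normalize u).
Proof. by move=> u0 hu; split=> [|i];
  [exact: twist_ge0|rewrite chart_poly_normalize]. Qed.

Lemma normalize_id u : real_chart u -> normalize u = u.
Proof.
move=> [_ hu]; have -> : normalize u = twist u 0.
  rewrite /normalize; congr twist; rewrite -[RHS](mulmx0 _ (intmx R K));
    congr (_ *m _).
  by apply/colP => i; rewrite !mxE hu ln1 oppr0.
by apply/colP => j; rewrite !mxE expR0 mulr1.
Qed.

Lemma chart_poly_continuous i : continuous (chart_poly i).
Proof.
move=> u; apply: (@cvg_big_sum R _ (nbhs u) _) => m mi; apply: cvgMr.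
by apply: monomial_continuous => j; exact: e_ge0.
Qed.

Lemma normalize_continuous u : (forall i, 0 < chart_poly i u) ->
  {for u, continuous normalize}.
Proof.
move=> hu; apply: (@cvg_mx _ (nbhs u) _) => j l; rewrite ord1.
rewrite /normalize [X in _ --> X]twistE.
under eq_fun do rewrite twistE; apply: cvgM; first exact: coord_continuous.
apply: continuous_cvg; first exact: continuous_expR.
rewrite mxE; under eq_fun do rewrite mxE.
apply: (@cvg_big_sum R _ (nbhs u) _) => i _; apply: cvgMr.
rewrite mxE; under eq_fun do rewrite mxE; apply: cvgN.
by apply: continuous_cvg; [exact: continuous_ln|exact: chart_poly_continuous].
Qed.

(** Density of the positive points in the chart, phrased through signs of continuous functions:
    [u + t(1,...,1)] is positive for [t > 0], and its normalization tends to [u]. *)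
Lemma chart_dense (p : 'cV[R]_n -> R) : continuous p ->
    (forall u, real_chart u -> (forall j, 0 < u j 0) -> 0 <= p u) ->
  forall u, real_chart u -> 0 <= p u.
Proof.
move=> pc ppos u uY; have [u0 hu] := uY.
pose w t : 'cV[R]_n := \col_j (u j 0 + t).
have w0 : w 0 = u by apply/colP => j; rewrite mxE addr0.
rewrite -(normalize_id uY) -w0.
apply: (@ge0_at0 R (fun t => p (normalize (w t)))) => [|t t0].
  apply: (@continuous_comp _ _ _ (fun t => normalize (w t)) p); last exact: pc.
  apply: (@continuous_comp _ _ _ w normalize); last first.
    by apply: normalize_continuous => i; rewrite w0 hu.
  apply: (@cvg_mx _ (nbhs (0 : R)) _) => j l; rewrite mxE;
    under eq_fun do rewrite mxE.
  by apply: cvgD; [exact: cvg_cst|exact: cvg_id].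
have wt j : 0 < w t j 0 by rewrite mxE ltr_wpDl.
apply: ppos => [|j]; first by apply: normalize_chart => [j|i];
  [exact/ltW|exact: chart_poly_gt0].
by rewrite mxE mulr_gt0// expR_gt0.
Qed.

Lemma orthogonal_eq0 u z : (forall j, 0 <= u j 0) ->
    (forall i, chart_poly i u != 0) -> (forall j, u j 0 = 0 -> z j 0 = 0) ->
    (forall i m, m \in E i -> monomial u (e i m) != 0 ->
       dotv (intmx R (e i m)) z = 0) ->
  z = 0.
Proof.
move=> u0 hu uz ez.
(* As exponents are nonnegative, [o] is orthogonal to exactly those exponents whose monomial does
   not vanish at [u]. *)
pose o : 'cV[R]_n := \col_j (u j 0 == 0)%:R.
have oE i m : m \in E i -> tight o (e i m) = (monomial u (e i m) != 0).
  move=> mi; rewrite /tight /dotv psumr_eq0 => [|j _]; last first.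
    by rewrite !mxE mulr_ge0// ler0z e_ge0.
  rewrite monomial_eq0 => [|j]; last exact: e_ge0.
  rewrite negb_exists; apply/allP/forallP => [oe j|oe j _]; last first.
    have := oe j; rewrite !mxE; case: (u j 0 == 0); rewrite /= ?mul0r//.
    by rewrite mul1r intr_eq0 negbK.
  have := oe j (mem_index_enum _); rewrite !mxE; case: (u j 0 == 0) => //=.
  by rewrite mul1r intr_eq0 negbK.
have /choice[mm mmP] : forall i, exists m, m \in E i /\ monomial u (e i m) != 0.
  by move=> i; have [m] := chart_poly_neq0 (hu i); exists m.
pose b := flatten [seq [seq e i m | m <- E i] | i <- enum 'I_k].
have bP (x : 'cV[int]_n) : x \in b -> exists i m, m \in E i /\ x = e i m.
  by move=> /flatten_mapP[i _ /mapP[m mi ->]]; exists i, m.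
have oN : in_cone b o.
  move=> _ /bP[i [m [mi ->]]]; apply: sumr_ge0 => j _.
  by rewrite !mxE mulr_ge0// ler0z e_ge0.
(* Nonnegativity suffices, since it can be applied to both [z] and [- z]. *)
suff zge0 y : (forall i m, m \in E i -> monomial u (e i m) != 0 ->
    dotv (intmx R (e i m)) y = 0) -> forall j, u j 0 != 0 -> 0 <= y j 0.
  apply/colP => j; rewrite mxE; have [/uz//|uj] := eqVneq (u j 0) 0.
  apply/eqP; rewrite eq_le zge0// andbT -oppr_ge0.
  suff : 0 <= (- z) j 0 by rewrite mxE.
  by apply: zge0 => // i m mi um; rewrite dotvNr ez ?oppr0.
move=> ey j uj.
have [_ /bP[i [m [mi ->]]]|eps eps0 yN] := in_cone_small (v := y) oN.
  by rewrite oE// => um; rewrite /tight dotvC ey.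
have oy0 i : dotv (intmx R (e i (mm i))) (o + eps *: y) = 0.
  have [mi um] := mmP i; rewrite dotvDr dotvZr ey// mulr0 addr0 dotvC.
  by apply/eqP; rewrite -/(tight o (e i (mm i))) oE.
(* All minima are 0, attained at [mm i], so completeness says that [o + eps *: y] is nonnegative; at
   [j] its entry is [eps * y j 0]. *)
have := @complete (o + eps *: y) mm (fun i => (mmP i).1).
rewrite (_ : \col_i _ = 0); last by apply/colP => i; rewrite mxE oy0 mxE.
rewrite mulmx0 => /(_ _ j); rewrite !mxE (negPf uj) add0r pmulr_rge0//.
apply => i m mi; rewrite oy0 dotvC yN//; apply/flatten_mapP.
by exists i; rewrite ?mem_enum// map_f.
Qed.

(** If the moment vanishes at [j] but [u] does not, all exponents with nonvanishing monomial have
    entry 0 at [j], and [delta_mx j 0] contradicts [orthogonal_eq0]. *)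
Lemma real_moment_eq0 u j : real_chart u -> (real_moment u j 0 == 0) = (u j 0 == 0).
Proof.
move=> [u0 hu]; rewrite momentE.
have t0 i m : m \in E i -> 0 <= weight i m u * (e i m j 0)%:~R.
  by move=> mi; rewrite mulr_ge0 ?weight_ge0// ler0z e_ge0.
have S0 i : 0 <= \sum_(m <- E i) weight i m u * (e i m j 0)%:~R.
  by rewrite big_seq sumr_ge0// => m /t0.
apply/idP/idP => [|uj].
  rewrite psumr_eq0 => [/allP sw|i _]; last by rewrite mulr_ge0// ltW.
  apply: contraT => uj; have : delta_mx j 0 = 0 :> 'cV[R]_n.
    apply: (orthogonal_eq0 u0) => [i|l ul|i m mi um]; first by rewrite hu oner_eq0.
      by rewrite mxE; case: eqP => // lj; rewrite -lj ul eqxx in uj.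
    rewrite dotv_delta mxE; have := sw i (mem_index_enum _).
    rewrite /= mulf_eq0 gt_eqF//= big_seq psumr_eq0 => [/allP/(_ m mi)|l /t0//].
    by rewrite mi/= mulf_eq0 weight_eq0// (negPf um) => /eqP.
  by move=> /colP/(_ j)/eqP; rewrite !mxE !eqxx oner_eq0.
rewrite big1// => i _; rewrite big_seq big1 ?mulr0// => m mi.
have [->|ej] := eqVneq (e i m j 0) 0; first by rewrite mulr0.
have /eqP -> : weight i m u == 0; last by rewrite mul0r.
rewrite weight_eq0// monomial_eq0 => [|l]; last exact: e_ge0.
by apply/existsP; exists j; rewrite uj.
Qed.

Lemma expR_mul_ge0 (x : R) : 0 <= (expR x - 1) * x.
Proof.
have [x0|x0] := leP 0 x; first by rewrite mulr_ge0// subr_ge0 -expR0 ler_expR.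
by rewrite mulr_le0 ?ltW// subr_lt0 expR_lt1.
Qed.

(* [real_moment] is the gradient, in the coordinates [ln u], of a convex function. *)
Lemma real_moment_inj u w : real_chart u -> real_chart w ->
  real_moment u = real_moment w -> u = w.
Proof.
move=> uY wY uw; have [u0 hu] := uY; have [w0 hw] := wY.
have uw0 j : (u j 0 == 0) = (w j 0 == 0).
  by rewrite -(real_moment_eq0 j uY) -(real_moment_eq0 j wY) uw.
(* The value at a zero coordinate does not affect the twist; 0 is what [orthogonal_eq0] requires. *)
pose z : 'cV[R]_n := \col_j if u j 0 == 0 then 0 else ln (w j 0) - ln (u j 0).
have wE : w = twist u z.
  apply/colP => j; rewrite !mxE; case: ifPn => [uj|uj].
    by rewrite (eqP uj) mul0r; apply/eqP; rewrite -uw0.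
  have uj0 : 0 < u j 0 by rewrite lt0r uj u0.
  have wj0 : 0 < w j 0 by rewrite lt0r -uw0 uj w0.
  by rewrite expRD expRN !lnK ?posrE// mulrCA mulfV// mulr1.
have : dotv (real_moment w) z - dotv (real_moment u) z = 0 by rewrite uw subrr.
(* Pairing the difference of moments with [z] gives a sum of nonnegative terms [(expR y - 1) * y].
   Equality forces [y = 0] for each exponent whose monomial does not vanish. *)
have tE i : s i 0 * \sum_(m <- E i) weight i m w * dotv (intmx R (e i m)) z -
    s i 0 * \sum_(m <- E i) weight i m u * dotv (intmx R (e i m)) z =
  s i 0 * \sum_(m <- E i) weight i m u *
    ((expR (dotv (intmx R (e i m)) z) - 1) * dotv (intmx R (e i m)) z).
  rewrite -mulrBr -sumrB; congr (_ * _); apply: eq_bigr => m _.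
  by rewrite wE weight_twist; ring.
rewrite !dotv_moment -sumrB; under eq_bigr do rewrite tE.
have t0 i m : m \in E i -> 0 <= weight i m u *
    ((expR (dotv (intmx R (e i m)) z) - 1) * dotv (intmx R (e i m)) z).
  by move=> mi; rewrite mulr_ge0 ?weight_ge0 ?expR_mul_ge0.
move=> /eqP; rewrite psumr_eq0 => [/allP sw|i _]; last first.
  by rewrite mulr_ge0 ?(ltW (s_gt0 i))// big_seq sumr_ge0// => m /t0.
suff z0 : z = 0 by rewrite wE z0; apply/colP => j; rewrite !mxE expR0 mulr1.
apply: (orthogonal_eq0 u0) => [i|j uj|i m mi um]; first by rewrite hu oner_eq0.
  by rewrite mxE uj eqxx.
have := sw i (mem_index_enum _).
rewrite /= mulf_eq0 gt_eqF//= big_seq psumr_eq0 => [/allP/(_ m mi)|l /t0//].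
rewrite mi/= mulf_eq0 weight_eq0// (negPf um)/= mulf_eq0 subr_eq0 -expR0 =>
  /orP[|/eqP//].
by move=> /eqP/expR_inj.
Qed.

Lemma real_chart_bounded : exists C : 'I_n -> R, forall u, real_chart u ->
  forall j, u j 0 <= C j.
Proof.
(* [L i] bounds the maximum [X i] of the exponents paired with [ln u]: as [chart_poly i] is 1, its
   dominant term is at most 1, and the sum of its coefficients times [expR (X i)] is at least 1. *)
pose L i := \sum_(m <- E i) `|ln (c i m)| + `|ln (\sum_(m <- E i) c i m)|.
pose B j := \sum_i `|(K j i)%:~R| * L i.
exists (fun j => expR (B j)) => u uY j; rewrite -subr_ge0.
apply: (@chart_dense (fun u => expR (B j) - u j 0) _ _ u uY) => [v|].
  by apply: (@cvgB _ _ _ (nbhs v)); [exact: cvg_cst|exact: coord_continuous].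
move=> {uY}u [_ hu] u0.
have um0 l : 0 <= u l 0 by exact: ltW.
pose y : 'cV[R]_n := \col_l ln (u l 0).
have monE (x : 'cV[int]_n) : monomial u x = expR (dotv (intmx R x) y).
  rewrite expR_sum; apply: eq_bigr => l _.
  by rewrite !mxE expR_intz lnK ?posrE.
have /choice[mm mmP] : forall i, exists m, m \in E i /\ forall m', m' \in E i ->
    - dotv (intmx R (e i m)) y <= - dotv (intmx R (e i m')) y.
  move=> i; have [|m mi mmin] := @seq_min _ _ (fun m => - dotv (intmx R (e i
    m)) y) (E i).
    have [m0 m0i] := E_neq0 i; have : m0 \in enum_fset (E i) by [].
    by case: (enum_fset (E i)).
  by exists m.
pose X i := dotv (intmx R (e i (mm i))) y.
have XL i : `|X i| <= L i.
  have [mi mmax] := mmP i; rewrite ler_norml; apply/andP; split.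
    have c0 : 0 < \sum_(m <- E i) c i m.
      rewrite (big_rem (mm i))//= ltr_pwDl ?c_gt0// big_seq sumr_ge0// => m mi'.
      by rewrite ltW// c_gt0//; exact: mem_rem mi'.
    rewrite lerNl; apply: (@le_trans _ _ (ln (\sum_(m <- E i) c i m))); last first.
      by apply: le_trans (ler_norm _) _; rewrite lerDr sumr_ge0.
    rewrite -ler_expR lnK ?posrE// expRN -[leLHS]mul1r ler_pdivrMr ?expR_gt0//.
    rewrite -(hu i) mulr_suml /chart_poly big_seq [leRHS]big_seq.
    apply: ler_sum => m mi'; rewrite ler_pM2l ?c_gt0// monE ler_expR -lerN2.
    exact: mmax.
  apply: (@le_trans _ _ (- ln (c i (mm i)))).
    rewrite -ler_expR expRN lnK ?posrE ?c_gt0// -[leRHS]mul1r ler_pdivlMr ?c_gt0//.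
    by rewrite -(hu i) mulrC -monE; exact: weight_le_chart_poly.
  rewrite /L (big_rem (mm i))//= -normrN; apply: le_trans (ler_norm _) _.
  by rewrite -addrA lerDl addr_ge0// sumr_ge0.
rewrite subr_ge0 -[u j 0]lnK ?posrE// ler_expR.
have := @complete (- y) mm (fun i => (mmP i).1).
have -> : \col_i dotv (intmx R (e i (mm i))) (- y) = - \col_i X i.
  by apply/colP => i; rewrite !mxE dotvNr.
rewrite mulmxN => /(_ _ j); rewrite mxE [(- y) _ _]mxE lerN2 [y _ _]mxE => yK.
apply: le_trans (yK _) _ => [i m mi|]; first by rewrite !dotvNr; exact: (mmP i).2.
rewrite mxE; apply: ler_sum => i _; rewrite !mxE.
apply: le_trans (ler_norm _) _; rewrite normrM.
by apply: ler_wpM2l.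
Qed.

Lemma real_chart_compact : compact real_chart.
Proof.
have [C YC] := real_chart_bounded.
have box : compact [set u : 'cV[R]_n | forall j, `[0, C j]%classic (u j 0)].
  by apply: (@cV_compact R n (fun j => `[0, C j]%classic)) => j;
    exact: segment_compact.
apply: subclosed_compact box _ => [|u uY j]; last first.
  by rewrite /= in_itv/= uY.1 YC.
have -> : real_chart = \bigcap_(j in [set: 'I_n]) [set u : 'cV[R]_n | 0 <= u j
  0] `&`
                       \bigcap_(i in [set: 'I_k]) [set u | chart_poly i u = 1].
  apply/seteqP; split=> [u [u0 hu]|u [u0 hu]]; split=> // j.
  - by move=> _; exact: u0.
  - by move=> _; exact: hu.
  - exact: u0 j I.
  - exact: hu j I.
apply: closedI; apply: closed_bigI => i _.
  have /continuous_closedP := @coord_continuous R n 1 i 0.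
  by move=> /(_ _ (@closed_ge R 0)).
by have /continuous_closedP/(_ _ (@closed_eq R 1)) := @chart_poly_continuous i.
Qed.

Lemma real_moment_polytope u : real_chart u -> moment_polytope (real_moment u).
Proof.
move=> [u0 hu]; split=> [|j]; last first.
  rewrite momentE sumr_ge0// => i _; rewrite mulr_ge0 ?(ltW (s_gt0 i))//.
  by rewrite big_seq sumr_ge0// => m mi; rewrite mulr_ge0 ?weight_ge0// ler0z e_ge0.
(* Pairing the moment with column [i] of [K] leaves only [s i 0 * chart_poly i u]. *)
apply/colP => i; have := dotv_moment u (intmx R K *m delta_mx i 0).
under eq_bigr => l _ do under eq_bigr do rewrite dotv_deg mxE andbT eq_sym.
rewrite (bigD1 i)//= [X in _ + X]big1 => [|l li]; last first.
  by rewrite big1 ?mulr0// => m _; rewrite eq_sym (negPf li) mulr0.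
under eq_bigr do rewrite eqxx mulr1;
  rewrite -/(chart_poly i u) hu mulr1 addr0 => <-.
rewrite dotvC !mxE /dotv; apply: eq_bigr => j _.
by rewrite -colE !mxE.
Qed.

Lemma chart_poly_twist_gt0 i u z : real_chart u -> 0 < chart_poly i (twist u z).
Proof.
move=> [u0 hu]; have [|m mi um] := @chart_poly_neq0 i u;
  first by rewrite hu oner_eq0.
apply: lt_le_trans (weight_le_chart_poly (twist_ge0 _ u0) mi).
by rewrite weight_twist mulr_gt0 ?expR_gt0// lt0r weight_ge0// weight_eq0// um.
Qed.

Section Surjectivity.
Variable x : 'cV[R]_n.
Hypothesis xS : moment_polytope x.

Let G u := \prod_j (`|u j 0| `^ x j 0).

Let G_twist u z : G (twist u z) = G u * expR (dotv x z).
Proof.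
rewrite expR_sum -big_split; apply: eq_bigr => j _ /=.
rewrite twistE normrM (ger0_norm (expR_ge0 _)) powRM ?expR_ge0//.
by congr (_ * _); rewrite /powR gt_eqF ?expR_gt0// expRK.
Qed.

(** The equation [K^t x = s] turns the effect of the normalization into a factor that depends on [s]
    only, not on [x]. *)
Let G_normalize u :
  G (normalize u) = G u * expR (- \sum_i s i 0 * ln (chart_poly i u)).
Proof.
rewrite G_twist; congr (_ * expR _).
rewrite dotvE mulmxA -{1}(trmxK (intmx R K)) -trmx_mul xS.1 mxE -sumrN.
by apply: eq_bigr => i _; rewrite !mxE mulrN.
Qed.

Let G_continuous : continuous G.
Proof.
move=> u; apply: (@cvg_big_prod R _ (nbhs u) _) => j.
apply: (@continuous_comp _ _ _ (fun u : 'cV[R]_n => u j 0) (fun t => `|t| `^ x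
  j 0)).
  exact: coord_continuous.
exact/powR_norm_continuous/xS.2.
Qed.

(* A maximizer of [u^x] on the chart is a preimage of [x], whether or not it
   lies on the boundary. *)
Lemma real_moment_surj : exists2 u, real_chart u & real_moment u = x.
Proof.
pose v0 := normalize (const_mx 1).
have v0pos j : 0 < v0 j 0 by rewrite /v0 /normalize twistE mulr_gt0 ?expR_gt0// mxE.
have v0Y : real_chart v0.
  by apply: normalize_chart => [j|i]; [rewrite mxE|apply: chart_poly_gt0 => j;
    rewrite mxE].
have [u /set_mem uY umax] := compact_EVT_max (ex_intro _ v0 v0Y) real_chart_compact
  (continuous_subspaceT G_continuous).
have [u0 hu] := uY.
have Gu : 0 < G u.
  apply: lt_le_trans (umax _ (mem_set v0Y)).
  by apply: prodr_gt0 => j _; rewrite powR_gt0// normr_gt0 gt_eqF.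
exists u => //; apply/colP => j.
(* [p] is the derivative of the sum of the [s_i h_i] along the twist of [u] by [t] in direction [j];
   at 0 it is the moment. *)
pose p t := \sum_i s i 0 * \sum_(m <- E i)
  weight i m u * (e i m j 0)%:~R * expR (t * (e i m j 0)%:~R).
have p0 : real_moment u j 0 = p 0.
  rewrite momentE; apply: eq_bigr => i _; congr (_ * _); apply: eq_bigr => m _.
  by rewrite mul0r expR0 mulr1.
have pc : continuous p.
  move=> t; apply: (@cvg_big_sum R _ (nbhs t) _) => i _; apply: cvgMr.
  apply: (@cvg_big_sum R _ (nbhs t) _) => m _; apply: cvgMr.
  apply: continuous_cvg; first exact: continuous_expR.
  by apply: cvgMl; exact: cvg_id.
(* Maximality of [u] against the normalized twist bounds [t * x j 0] by the sum of the [s_i ln h_i].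
   Then [ln h <= h - 1] and [expR y - 1 <= y * expR y] are applied. *)
have ptx t : t * x j 0 <= t * p t.
  pose w := twist u (t *: delta_mx j 0).
  have w_ge0 : forall l, 0 <= w l 0 by exact: twist_ge0.
  have hw i : 0 < chart_poly i w by exact: chart_poly_twist_gt0.
  have := umax _ (mem_set (normalize_chart w_ge0 hw)).
  rewrite G_normalize G_twist -mulrA -expRD dotvZr dotv_delta.
  rewrite -[leRHS]mulr1 ler_pM2l// -expR0 ler_expR subr_le0 => /le_trans; apply.
  rewrite mulr_sumr; apply: ler_sum => i _; rewrite mulrCA ler_pM2l//.
  have -> : ln (chart_poly i w) = ln (1 + (chart_poly i w - 1)) by rewrite
    addrC subrK.
  apply: le_trans (le_ln1Dx _) _; first by rewrite ltrBrDl subrr.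
  rewrite -[X in _ - X <= _](hu i) /chart_poly -sumrB mulr_sumr big_seq
    [leRHS]big_seq.
  apply: ler_sum => m mi; rewrite weight_twist dotvZr dotv_delta mxE.
  set y := t * _; set W := weight i m u.
  have -> : t * (W * (e i m j 0)%:~R * expR y) = W * (y * expR y).
    by rewrite /y; ring.
  rewrite -[X in _ - X]mulr1 -mulrBr ler_wpM2l ?weight_ge0//.
  have := expR_ge1Dx (- y); rewrite expRN => ey.
  have := expR_gt0 y => ey0.
  have : (1 - y) * expR y <= 1 by rewrite -ler_pdivlMr// div1r.
  lra.
(* For [t > 0], [ptx] at [- t] and at [t] gives [p (- t) <= x j 0 <= p t]; let [t] tend to 0. *)
apply/eqP; rewrite p0 eq_le; apply/andP; split; rewrite -subr_ge0.
  have -> : p 0 = p (- 0) by rewrite oppr0.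
  apply: (@ge0_at0 R (fun t => x j 0 - p (- t))) => [|t t0].
    apply: (@cvgB _ _ _ (nbhs (0 : R))); first exact: cvg_cst.
    apply: (@continuous_comp _ _ _ -%R p); last exact: pc.
    exact: opp_continuous.
  by have := ptx (- t); rewrite !mulNr lerN2 ler_pM2l// subr_ge0.
apply: (@ge0_at0 R (fun t => p t - x j 0)) => [|t t0].
  by apply: (@cvgB _ _ _ (nbhs (0 : R))); [exact: pc|exact: cvg_cst].
by have := ptx t; rewrite ler_pM2l// subr_ge0.
Qed.

End Surjectivity.

Lemma real_moment_image : real_moment @` real_chart = moment_polytope.
Proof.
apply/seteqP; split=> [_ [u uY <-]|x /real_moment_surj[u uY <-]].
  exact: real_moment_polytope.
by exists u.
Qed.

(** * The moment polytope as the convex hull of a finite set *)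

Definition moment_vertices : set 'cV[R]_n :=
  [set \sum_i s i 0 *: intmx R (e i (mm i)) | mm in
    [set mm : 'I_k -> 'cV[int]_d | forall i, mm i \in E i]].

Lemma finite_moment_vertices : finite_set moment_vertices.
Proof.
(* Choices of exponents are encoded by their positions in the supports, all below [N.+1]. *)
pose N := \max_i size (E i).
pose g (q : {ffun 'I_k -> 'I_N.+1}) : 'cV[R]_n :=
  \sum_i s i 0 *: intmx R (e i (nth 0 (E i) (q i))).
apply: (@sub_finite_set _ _ (range g)); last exact/finite_image/finite_finset.
move=> _ [mm mmE <-]; exists [ffun i => inord (index (mm i) (E i))] => //.
apply: eq_bigr => i _; rewrite ffunE inordK ?nth_index//.
rewrite ltnS (leq_trans (index_size _ _))//.
exact: (leq_bigmax (F := fun i => size (E i))).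
Qed.

Lemma moment_vertices_polytope : moment_vertices `<=` moment_polytope.
Proof.
move=> _ [mm mmE <-].
have degE i : (intmx R K)^T *m intmx R (e i (mm i)) = delta_mx i 0.
  by rewrite -intmx_tr -intmxM e_deg intmx_delta.
split=> [|j].
  apply/colP => i; rewrite mulmx_sumr summxE (bigD1 i)//= big1 => [|l li].
    by rewrite addr0 -scalemxAr mxE degE mxE !eqxx mulr1.
  by rewrite -scalemxAr mxE degE mxE eq_sym (negPf li) mulr0.
rewrite summxE sumr_ge0// => i _; rewrite !mxE mulr_ge0 ?(ltW (s_gt0 i))//.
by rewrite ler0z e_ge0//; exact: mmE.
Qed.

Lemma moment_polytope_convex : @convex_set R 'cV[R]_n moment_polytope.
Proof.
apply: convex_setP => x y t [xs x0] [ys y0] /andP[t0 t1]; split=> [|j].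
  by rewrite mulmxDr -!scalemxAr xs ys -scalerDl addrC subrK scale1r.
by rewrite !mxE addr_ge0// mulr_ge0// subr_ge0.
Qed.

(** By surjectivity every point is a moment, hence an [s]-weighted sum of convex combinations of
    exponents: the weights of a chart point sum to 1 for each [i]. *)
Lemma moment_polytope_hull : moment_polytope = conv_hull moment_vertices.
Proof.
apply/seteqP; split=> [|x]; last first.
  exact: (smallest_sub moment_polytope_convex moment_vertices_polytope).
rewrite -real_moment_image => _ [u [u0 hu] <-].
apply: (convex_minkowski (A := fun i => [set intmx R (e i m) | m in [set` E i]])).
- exact: conv_hull_convex.
- move=> p pE; apply: sub_gen_smallest.
  have /choice[mm mmP] : forall i, exists m, m \in E i /\ intmx R (e i m) = p i.
    by move=> i; have [m mi <-] := pE i; exists m.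
  exists mm => [i|]; first exact: (mmP i).1.
  by apply: eq_bigr => i _; rewrite (mmP i).2.
- move=> i; apply: convex_sum => //.
  + exact: conv_hull_convex.
  + by move=> m mi; exact: weight_ge0.
  + by move=> m mi; apply: sub_gen_smallest; exists m.
  + exact: hu.
Qed.

End Chart.

(** * Nonnegative points of the complex chart *)

Section ComplexVectors.
Variable R : realType.

Lemma real_complex_continuous : continuous (real_complex R : R -> R[i]).
Proof.
move=> x; apply/(@cvgrPdist_lt _ R[i]^o) => eps eps0.
have epsE : eps = (complex.Re eps)%:C.
  by move: eps0; rewrite ltcE => /andP[/eqP]; case: eps => u v /= ->.
have e0 : 0 < complex.Re eps by move: eps0; rewrite ltcE => /andP[].
near=> y; rewrite -rmorphB /= normc_def /= expr0n addr0 sqrtr_sqr epsE ltcR.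
near: y; apply: (@cvgr_dist_lt _ R^o) => //; exact: cvg_id.
Unshelve. all: by end_near. Qed.

Lemma complexmx_continuous n : continuous (@complexmx R n 1).
Proof.
move=> u; apply: (@cvg_mx _ (nbhs u) _) => i j; rewrite mxE.
under eq_fun do rewrite mxE.
apply: (@continuous_comp _ _ _ (fun u : 'cV[R]_n => u i j) (real_complex R)).
  exact: coord_continuous.
exact: real_complex_continuous.
Qed.

Lemma complexmx_inj m n : injective (@complexmx R m n).
Proof.
move=> A B AB; apply/matrixP => i j.
by have /matrixP/(_ i j) := AB; rewrite !mxE => -[].
Qed.

Lemma complex_ge0P (z : R[i]) : 0 <= z -> exists2 x : R, 0 <= x & z = x%:C.
Proof.
by case: z => x y; rewrite lecE /= => /andP[/eqP -> x0]; exists x.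
Qed.

Lemma cV_hausdorff n : hausdorff_space 'cV[R[i]]_n.
Proof. exact: (@norm_hausdorff _ 'cV[R[i]]_n). Qed.

Lemma monomial_complexmx n (u : 'cV[R]_n) x :
  monomial (complexmx u) x = (monomial u x)%:C.
Proof. exact: monomial_morph. Qed.

(** At real points the real and imaginary parts of a complex polynomial are real polynomials, to
    which [chart_dense] applies. *)
Lemma meval_complexmx_continuous n (p : mpoly.mpoly n R[i]) :
  continuous (fun u : 'cV[R]_n =>
    complex.Re (mpoly.meval (fun j => complexmx u j 0) p)) /\
  continuous (fun u : 'cV[R]_n =>
    complex.Im (mpoly.meval (fun j => complexmx u j 0) p)).
Proof.
pose q (h : R[i] -> R) (u : 'cV[R]_n) := \sum_(m <- mpoly.msupp p)
  h (mpoly.mcoeff m p) * \prod_j (u j 0) ^+ mpoly.fun_of_multinom m j.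
have qc h : continuous (q h).
  move=> u; rewrite /q; elim: (mpoly.msupp p) => [|m r IHr].
    by under eq_fun do rewrite big_nil; exact: cst_continuous.
  under eq_fun do rewrite big_cons; rewrite /continuous_at /= ?big_cons.
  apply: (@cvgD _ _ _ (nbhs u)); last exact: IHr.
  apply: cvgMr; apply: (@cvg_big_prod R _ (nbhs u) _) => j.
  have := @coord_continuous R n 1 j 0 u.
  elim: (mpoly.fun_of_multinom m j) => [|l IHl] uj; first exact: cvg_cst.
  by under eq_fun do rewrite exprS; rewrite exprS; apply: cvgM;
    [exact: uj|exact: IHl].
have qE u : mpoly.meval (fun j => complexmx u j 0) p =
    (q (@complex.Re R) u +i* q (@complex.Im R) u)%C.
  rewrite mpoly.mevalE /q; elim: (mpoly.msupp p) => [|m l IHl];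
    first by rewrite !big_nil.
  rewrite !big_cons IHl.
  have -> : \prod_j complexmx u j 0 ^+ mpoly.fun_of_multinom m j =
            (\prod_j u j 0 ^+ mpoly.fun_of_multinom m j)%:C.
    by rewrite rmorph_prod; apply: eq_bigr => j _; rewrite mxE rmorphXn.
  case: (mpoly.mcoeff m p) => x y; apply/eqP; rewrite eq_complex /=.
  by rewrite !mulr0 subr0 add0r !eqxx.
by split=> u; under eq_fun do rewrite qE; exact: qc.
Qed.

End ComplexVectors.

(** * From the polytope data to the complex chart *)

Section Link.
Import (canonicals) mpoly.
Variables (R : realType) (d k : nat) (f : 'I_k -> laurent R d).
Variables (F : 'M[int]_(d, d + k)) (a : 'M[int]_(k, d + k)) (s : 'cV[R]_k).
Let P := minkowski_sum (fun i => newton (f i)).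
Let M := col_mx F a.
Let K := rsubmx (invmx M).
Hypothesis f_ge0 : forall i m, 0 <= f i m.
Hypothesis dimP : has_dim P d.
Hypothesis rayF : is_ray_matrix P F.
Hypothesis suppF : support_matrix f F a.
Hypothesis unitM : M \in unitmx.
Hypothesis s_gt0 : forall i, 0 < s i 0.

Let E i := finsupp (f i).
Let c i m : R := complex.Re (f i m).
Let e i m : 'cV[int]_(d + k) := Defs.eta F (row i a)^T m.

Let fE i m : f i m = (c i m)%:C.
Proof. by rewrite /c; have [x _ ->] := complex_ge0P (f_ge0 i m). Qed.

Let c_gt0 i m : m \in E i -> 0 < c i m.
Proof.
rewrite /E mem_finsupp => fm; have [x x0 fx] := complex_ge0P (f_ge0 i m).
rewrite /c fx /= lt0r x0 andbT; apply: contra fm => /eqP x00.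
by rewrite fx x00.
Qed.

Let E_neq0 i : exists m, m \in E i.
Proof. exact: finsupp_neq0. Qed.

Let e_ge0 i m j : m \in E i -> 0 <= e i m j 0.
Proof. exact: eta_ge0. Qed.

Let eE i m : e i m = M^T *m col_mx m (delta_mx i 0).
Proof.
rewrite /e /Defs.eta /M tr_col_mx mul_row_col; congr (_ + _).
by rewrite -colE tr_row.
Qed.

Let MK : M *m K = col_mx 0 1%:M.
Proof. by rewrite /K mulmx_rsub mulmxV// scalar_mx_block block_mxEh row_mxKr. Qed.

Let FG : F *m lsubmx (invmx M) = 1%:M.
Proof.
have : M *m lsubmx (invmx M) = col_mx 1%:M 0.
  by rewrite mulmx_lsub mulmxV// scalar_mx_block block_mxEh row_mxKl.
by rewrite mul_col_mx => /eq_col_mx[].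
Qed.

(** This shows that the kernel of [K^t] lies in the image of [F^t]. *)
Let MT : F^T *m (lsubmx (invmx M))^T + a^T *m K^T = 1%:M.
Proof.
by rewrite -!trmx_mul -linearD/= -mul_row_col hsubmxK mulVmx// trmx1.
Qed.

Let e_deg i m : K^T *m e i m = delta_mx i 0.
Proof.
rewrite eE mulmxA -trmx_mul MK tr_col_mx trmx0 trmx1 mul_row_col.
by rewrite mul0mx add0r mul1mx.
Qed.

Let dotv_e i m (z : 'cV[R]_(d + k)) : dotv (intmx R (e i m)) z =
  dotv (intmx R m) (usubmx (intmx R M *m z)) + dsubmx (intmx R M *m z) i 0.
Proof.
have -> : dotv (intmx R (e i m)) z =
    dotv (intmx R (col_mx m (delta_mx i 0))) (intmx R M *m z).
  by rewrite !dotvE eE intmxM trmx_mul -mulmxA intmx_tr trmxK.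
rewrite -{1}[intmx R M *m z]vsubmxK intmx_col_mx dotv_col_mx intmx_delta.
by rewrite [X in _ + X]dotvC dotv_delta.
Qed.

Let complete (z : 'cV[R]_(d + k)) (mm : 'I_k -> 'cV[int]_d) :
  (forall i, mm i \in E i) ->
  (forall i m, m \in E i ->
     dotv (intmx R (e i (mm i))) z <= dotv (intmx R (e i m)) z) ->
  forall j, (intmx R K *m \col_i dotv (intmx R (e i (mm i))) z) j 0 <= z j 0.
Proof.
move=> mmE mmin j; pose w := usubmx (intmx R M *m z).
have wmin i m : m \in E i -> dotv w (intmx R (mm i)) <= dotv w (intmx R m).
  by move=> mi; rewrite !(dotvC w); have := mmin i m mi; rewrite !dotv_e lerD2r.
have := fan_complete dimP rayF suppF mmE unitM wmin j.
set h := \col_i dotv (intmx R (e i (mm i))) z.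
(* With [w] the first block of [M z], the second block of [M z] is absorbed by [h]; applying [M^-1]
   yields [z - K h]. *)
have -> : col_mx w (\col_i - dotv w (intmx R (mm i))) = intmx R M *m z - col_mx 0 h.
  rewrite -[intmx R M *m z]vsubmxK opp_col_mx add_col_mx oppr0 addr0; congr col_mx.
  apply/colP => i; rewrite mxE [RHS]mxE [(- h) _ _]mxE [h _ _]mxE dotv_e -/w dotvC.
  by rewrite opprD addrCA subrr addr0.
rewrite -/M mulmxBr mulmxA -intmxM mulVmx// intmx1 mul1mx -{1}[invmx M]hsubmxK.
have -> : intmx R (row_mx (lsubmx (invmx M)) (rsubmx (invmx M))) =
    row_mx (intmx R (lsubmx (invmx M))) (intmx R K) by rewrite /intmx map_row_mx.
by rewrite mul_row_col mulmx0 add0r !mxE subr_ge0.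
Qed.

Let Y := real_chart E c e.
Let Phi := real_moment E c e s.

Let eval_e i (u : 'cV[R[i]]_(d + k)) : torus u ->
  \sum_(m <- E i) f i m * monomial u (e i m) =
  laurent_eval (f i) (monomial_map F^T u) * monomial u (row i a)^T.
Proof.
move=> u0; rewrite mulr_suml; apply: eq_bigr => m _.
by rewrite monomial_comp// -mulrA -monomialD.
Qed.

Let chart_poly_complexmx i u :
  \sum_(m <- E i) f i m * monomial (complexmx u) (e i m) =
  (chart_poly E c e i u)%:C.
Proof.
rewrite rmorph_sum; apply: eq_bigr => m _.
by rewrite fE monomial_complexmx -rmorphM.
Qed.

(** The preimage [t] consists of the monomials of [u] given by the rows of [F]. The equation
    [h_i(u) = 1] reads [f_i(t) u^a_i = 1], so the graph point of [t] is the image of [u] under the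
    invertible map of [M^T]. *)
Let chart_torus_pos u : Y u -> (forall j, 0 < u j 0) ->
  chart_torus f M (complexmx u).
Proof.
move=> [_ hu] u0; have cu : torus (complexmx u).
  by move=> j; rewrite mxE; apply: contraTneq (u0 j) => -[->]; rewrite ltxx.
pose t := monomial_map F^T (complexmx u).
have fa i : laurent_eval (f i) t * monomial (complexmx u) (row i a)^T = 1.
  by rewrite -eval_e// chart_poly_complexmx hu.
have ft i : laurent_eval (f i) t != 0.
  by apply: contra_eq_neq (fa i) => ->; rewrite mul0r eq_sym oner_neq0.
exists t; first by split=> //; exact: monomial_map_torus.
have -> : graph_inv f t = monomial_map M^T (complexmx u).
  rewrite /M tr_col_mx monomial_map_row_mx; congr col_mx.
  apply/colP => i; rewrite !mxE -tr_row; apply: (mulfI (ft i)).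
  by rewrite mulfV// fa.
rewrite monomial_map_comp// -trmx_mul mulVmx// trmx1.
exact: monomial_map1.
Qed.

Let chart_torus_eq1 i u : chart_torus f M u ->
  \sum_(m <- E i) f i m * monomial u (e i m) = 1.
Proof.
move=> [t [t0 ft] <-]; have y0 : torus (graph_inv f t).
  by apply: torus_col_mx => // j; rewrite mxE invr_neq0.
have mE m : monomial (monomial_map (invmx M)^T (graph_inv f t)) (e i m) =
            monomial t m * (laurent_eval (f i) t)^-1.
  rewrite monomial_comp// eE mulmxA -trmx_mul mulmxV// trmx1 mul1mx.
  by rewrite monomial_col_mx monomial_delta mxE.
under eq_bigr do rewrite mE mulrA.
by rewrite -mulr_suml; exact: mulfV (ft i).
Qed.

Let defining_poly i : mpoly.mpoly (d + k) R[i] :=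
  \sum_(m <- E i) mpoly.mpolyC (d + k) (f i m) *
    (\prod_j mpoly.mpolyX R[i] (mpoly.mnm1 j) ^+ absz (e i m j 0)) - 1.

Let meval_defining_poly i (u : 'cV[R[i]]_(d + k)) :
  mpoly.meval (fun j => u j 0) (defining_poly i) =
  \sum_(m <- E i) f i m * monomial u (e i m) - 1.
Proof.
rewrite rmorphB rmorph1 rmorph_sum; congr (_ - _).
rewrite big_seq [RHS]big_seq; apply: eq_bigr => m mi.
rewrite rmorphM /= mpoly.mevalC rmorph_prod; congr (_ * _); apply: eq_bigr => j _.
by rewrite rmorphXn /= mpoly.mevalXU -[in RHS](gez0_abs (e_ge0 j mi)).
Qed.

(** The polynomials [h_i - 1] vanish on the torus part, hence on its closure. Conversely, a
    polynomial vanishing on the torus part vanishes at the positive points of [Y], and by density on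
    [Y]. *)
Lemma chart_ge0E : chart_ge0 f M = @complexmx R (d + k) 1 @` Y.
Proof.
apply/seteqP; split=> [u [uU u0]|_ [u uY <-]].
  pose v : 'cV[R]_(d + k) := \col_j complex.Re (u j 0).
  have vE : complexmx v = u.
    by apply/colP => j; rewrite !mxE; have [x _ ->] := complex_ge0P (u0 j).
  exists v => //; split=> [j|i].
    by rewrite mxE; have [x x0 ->] := complex_ge0P (u0 j).
  have /(uU (defining_poly i)) : forall w, chart_torus f M w ->
      mpoly.meval (fun j => w j 0) (defining_poly i) = 0.
    by move=> w wU; rewrite meval_defining_poly chart_torus_eq1// subrr.
  rewrite meval_defining_poly -vE chart_poly_complexmx => /eqP.
  by rewrite subr_eq0 => /eqP[].
have [u0 _] := uY; split=> [p pU|j]; last by rewrite mxE ler0c.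
have [Rec Imc] := meval_complexmx_continuous p.
have zero (h : 'cV[R]_(d + k) -> R) : continuous h ->
    (forall v, Y v -> (forall j, 0 < v j 0) -> h v = 0) -> h u = 0.
  move=> hc h0; apply/eqP; rewrite eq_le -oppr_ge0; apply/andP; split.
    have nhc : continuous (fun u => - h u).
      by move=> v; apply: (@cvgN _ _ _ (nbhs v)); exact: hc.
    apply: (@chart_dense R d (d + k) k E c e K c_gt0 E_neq0 e_ge0 e_deg
      _ nhc _ u uY) => v vY v0.
    by rewrite h0// oppr0.
  apply: (@chart_dense R d (d + k) k E c e K c_gt0 E_neq0 e_ge0 e_deg
      h hc _ u uY) => v vY v0.
  by rewrite h0.
apply/eqP; rewrite eq_complex; apply/andP; split; apply/eqP.
  by apply: (zero _ Rec) => v vY v0; rewrite pU//; exact: chart_torus_pos.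
by apply: (zero _ Imc) => v vY v0; rewrite pU//; exact: chart_torus_pos.
Qed.

(** Lattice points of the Newton polytope outside the support have coefficient 0. *)
Lemma moment_mapE u : moment_map f F a s u = \sum_i (s i 0)%:C *:
  \sum_(m <- E i) (f i m * monomial u (e i m)) *: intmx R[i] (e i m).
Proof.
apply: eq_bigr => i _; congr (_ *: _).
rewrite (fsbigE (E i)) //=; first last.
- by move=> m _ mi; rewrite (fsfun_dflt mi) mul0r scale0r.
- by move=> m mi; apply: sub_gen_smallest; exists m.
rewrite big_seq_cond [RHS]big_seq; apply: eq_bigl => m.
case: (boolP (m \in E i)) => //= mi; apply/mem_set.
by apply: sub_gen_smallest; exists m.
Qed.

Lemma moment_map_complexmx u :
  moment_map f F a s (complexmx u) = complexmx (Phi u).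
Proof.
apply/colP => j; rewrite moment_mapE summxE [RHS]mxE momentE rmorph_sum.
apply: eq_bigr => i _; rewrite mxE summxE rmorphM rmorph_sum; congr (_ * _).
apply: eq_bigr => m _; rewrite !mxE fE monomial_complexmx.
by rewrite rmorphM rmorphM rmorph_int.
Qed.

Lemma moment_map_continuous : continuous (moment_map f F a s).
Proof.
move=> u; apply: (@cvg_mx _ (nbhs u) _) => j l; rewrite ord1.
have mE v : moment_map f F a s v j 0 = \sum_i (s i 0)%:C *
    \sum_(m <- E i) (f i m * monomial v (e i m)) * (e i m j 0)%:~R.
  rewrite moment_mapE summxE; apply: eq_bigr => i _; rewrite mxE summxE.
  by congr (_ * _); apply: eq_bigr => m _; rewrite !mxE.
rewrite [X in _ --> X]mE; under eq_fun do rewrite mE.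
apply: (@cvg_big_sum R[i] _ (nbhs u) _) => i _.
apply: (@cvgMr R[i]).
apply: (@cvg_big_sum R[i] _ (nbhs u) _) => m mi; apply: cvgMl; apply: cvgMr.
by apply: (@monomial_continuous R[i]) => l'; exact: e_ge0.
Qed.

Lemma moment_map_homeo : homeomorphic_onto_image (chart_ge0 f M) (moment_map f
  F a s).
Proof.
have mc : {within chart_ge0 f M, continuous (moment_map f F a s)}.
  by apply: continuous_subspaceT; exact: moment_map_continuous.
split=> //.
have inj u v : chart_ge0 f M u -> chart_ge0 f M v ->
    moment_map f F a s u = moment_map f F a s v -> u = v.
  rewrite chart_ge0E => -[{}u uY <-] [{}v vY <-].
  rewrite !moment_map_complexmx => /complexmx_inj uv; congr complexmx.
  exact: (real_moment_inj c_gt0 e_ge0 complete s_gt0 uY vY uv).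
(* [g] picks a preimage, with default value 0 off the image. *)
pose g y := xget 0 [set u | chart_ge0 f M u /\ moment_map f F a s u = y].
have gK : {in chart_ge0 f M, cancel (moment_map f F a s) g}.
  move=> u /set_mem uU; rewrite /g; case: xgetP => [v _ [vU vu]|/(_ u)[]//].
  exact: inj.
exists g; first exact: gK.
have Ucpt : compact (chart_ge0 f M); last first.
  exact: (compact_injective_inverse Ucpt (@cV_hausdorff R (d + k)) mc gK).
rewrite chart_ge0E; apply: continuous_compact.
  by apply: continuous_subspaceT; exact: complexmx_continuous.
exact: (real_chart_compact c_gt0 E_neq0 e_ge0 e_deg complete).
Qed.

Lemma moment_map_image : moment_map f F a s @` chart_ge0 f M =
  [set complexmx x | x in moment_polytope K s].
Proof.
rewrite chart_ge0E -(real_moment_image c_gt0 E_neq0 e_ge0 e_deg complete s_gt0).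
apply/seteqP; split=> [_ [_ [u uY <-] <-]|_ [_ [u uY <-] <-]].
  by exists (Phi u); [exists u|rewrite moment_map_complexmx].
by exists (complexmx u); [exists u|rewrite moment_map_complexmx].
Qed.

Lemma moment_polytope_is_polytope : is_polytope (moment_polytope K s).
Proof.
exists (moment_vertices E e s); first exact: finite_moment_vertices.
exact: (moment_polytope_hull c_gt0 E_neq0 e_ge0 e_deg complete s_gt0).
Qed.

Lemma moment_polytope_dim : has_dim (moment_polytope K s) d.
Proof.
have BS := moment_vertices_polytope e_ge0 e_deg s_gt0.
have /choice[m0 m0E] := E_neq0.
split; first by eexists; apply: BS; exists m0.
pose h : 'Hom('cV[R]_d, 'cV[R]_(d + k)) := linfun (mulmx (intmx R F)^T).
have hE x : h x = (intmx R F)^T *m x by rewrite lfunE.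
(* The direction space is the image of [F^t], of dimension [d] because [F] has a right inverse. *)
exists (limg h); split.
- have ker0 : lker h = 0%VS.
    apply/eqP; rewrite -subv0; apply/subvP => x;
      rewrite memv_ker memv0 hE => /eqP Fx.
    by rewrite -[x]mul1mx -[1%:M]trmx1 -intmx1 -FG intmxM trmx_mul -mulmxA Fx
      mulmx0.
  rewrite limg_dim_eq; first by rewrite dimvf /dim/= muln1.
  by rewrite ker0 capv0.
- move=> x y [xs _] [ys _]; pose z := x - y.
  have Kz : (intmx R K)^T *m z = 0 by rewrite mulmxBr xs ys subrr.
  rewrite -/z; suff -> : z = h ((intmx R (lsubmx (invmx M)))^T *m z) by rewrite
    memv_img ?memvf.
  rewrite hE mulmxA -!intmx_tr -intmxM -[LHS]mul1mx -intmx1 -MT intmxD mulmxDl.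
  by rewrite [X in _ + X](_ : _ = 0) ?addr0// intmxM -mulmxA (intmx_tr R K) Kz
    mulmx0.
- move=> W WS; apply/subvP => _ /memv_imgP[x _ ->].
  suff /(_ x) : forall x, x \in (h @^-1: W)%VS by rewrite memv_preim.
  apply: (span_differences dimP) => i m m' mi m'i; rewrite -memv_preim hE.
  (* Two points of [moment_vertices] whose choices differ only at [i] have difference
     [s_i F^t (m - m')]; such differences span by [span_differences]. *)
  pose q m i' := if i' == i then m else m0 i'.
  have qE m1 : m1 \in E i -> moment_polytope K s
      (\sum_i' s i' 0 *: intmx R (e i' (q m1 i'))).
    move=> m1i; apply: BS; exists (q m1) => // i'; rewrite /q.
    by case: eqP => // ->.
  have := WS _ _ (qE m mi) (qE m' m'i); rewrite -sumrB (bigD1 i)//= big1 => [|l li].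
    rewrite addr0 /q eqxx -scalerBr => /(memvZ (s i 0)^-1).
    rewrite scalerA mulVf ?gt_eqF// scale1r -intmxB /e /Defs.eta opprD addrACA
      subrr addr0 -mulmxBr.
    by rewrite intmxM intmx_tr.
  by rewrite /q (negPf li) subrr.
Qed.

End Link.

Theorem theorem5p1 (R : realType) (d k : nat) (f : 'I_k -> laurent R d)
    (F : 'M[int]_(d, d + k)) (a : 'M[int]_(k, d + k)) (s : 'cV[R]_k) :
  let P := minkowski_sum (fun i => newton (f i)) in
  let M := col_mx F a in
  let K := rsubmx (invmx M) in
  let mu := moment_map f F a s in
  let S := [set x : 'cV[R]_(d + k) |
              (intmx R K)^T *m x = s /\ forall j, 0 <= x j 0] in
  (forall i m, 0 <= f i m) ->
  has_dim P d ->
  ([set Q | is_facet P Q] #= `I_(d + k))%card ->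
  is_ray_matrix P F ->
  support_matrix f F a ->
  \det M = 1 \/ \det M = -1 ->
  (forall i, 0 < s i 0) ->
  [/\ homeomorphic_onto_image (chart_ge0 f M) mu,
      mu @` chart_ge0 f M = [set complexmx x | x in S],
      is_polytope S
    & has_dim S d].
Proof.
move=> P M K mu S f0 dimP _ rayF suppF detM s0.
have unitM : M \in unitmx.
  by rewrite unitmxE; case: detM => ->; rewrite ?unitrN1 ?unitr1.
split.
- exact: moment_map_homeo.
- exact: moment_map_image.
- exact: (moment_polytope_is_polytope f0 dimP rayF suppF unitM s0).
- exact: (moment_polytope_dim dimP suppF unitM s0).
Qed.
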